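(* Consider the JSQ$(d(N))$ scheme with $\lambda(N)/N\to\lambda\le B$ and $d(N)\to\infty$ as $N\to\infty$. Let $\pi^{d(N)}(\cdot)=\lim_{t\to\infty}\mathbb{P}(\mathbf{q}^{d(N)}(t)=\cdot)$ be the stationary measure of the fluid-scaled occupancy state of the $N$-th system. Then the sequence $\{\pi^{d(N)}\}_{N\ge1}$ converges weakly to $\pi^\star=\delta_{\mathbf{q}^\star}$, the Dirac measure concentrated at $\mathbf{q}^\star$, where, with $K=\lfloor\lambda\rfloor$ and $f=\lambda-K$, $$q_i^\star=1\ \text{ for } i=1,\ldots,K,\qquad q_{K+1}^\star=f,\qquad q_i^\star=0\ \text{ for } i=K+2,\ldots,B.$$
   Context: System: for each $N\ge1$ there are $N$ identical server pools and a single dispatcher. Tasks arrive as a Poisson process of rate $\lambda(N)$. Tasks cannot be queued: each arriving task is immediately assigned to a server pool and starts execution at once. Execution times are independent exponential with unit mean and do not depend on the number of other tasks in service (all tasks at a pool are executed in parallel). Each pool can hold at most $B$ simultaneous tasks, $B\in\{1,2,\ldots\}\cup\{\infty\}$; a task assigned to a pool already holding $B$ tasks is permanently discarded. It is assumed that $\lambda(N)/N\to\lambda$ with $0<\lambda\le B$. JSQ$(d(N))$ scheme ($1\le d(N)\le N$): each arriving task is assigned to the server pool with the minimum number of active tasks among $d(N)$ server pools selected uniformly at random (independently at each arrival; ties broken arbitrarily). The case $d(N)=N$ is the ordinary JSQ policy. $Q_i^{d(N)}(t)$ is the number of server pools with $i$ or more active tasks at time $t$, $i=1,\ldots,B$;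 $\mathbf{q}^{d(N)}(t)=(Q_1^{d(N)}(t),\ldots,Q_B^{d(N)}(t))/N$, which takes values in $S=\{\mathbf{q}\in[0,1]^B: q_i\le q_{i-1}\text{ for all } i=2,\ldots,B\}$ with the product topology (metric $\rho(\mathbf{q}_1,\mathbf{q}_2)=\sum_{i=1}^B 2^{-i}|q_{1,i}-q_{2,i}|$). *)

(* Defs.v *)
From HB Require Import structures.
From mathcomp Require Import all_boot all_order all_algebra.
From mathcomp Require Import all_classical all_reals all_analysis.

Set Implicit Arguments.
Unset Strict Implicit.
Unset Printing Implicit Defensive.

Import Order.TTheory GRing.Theory Num.Theory.
Import numFieldNormedType.Exports.

Local Open Scope classical_set_scope.
Local Open Scope ring_scope.

Definition borel (T : ptopologicalType) := g_sigma_algebraType (@open T).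

Definition weak_cvg (R : realType) (T : ptopologicalType)
    (mu : nat -> probability (borel T) R) (nu : probability (borel T) R) :=
  forall phi : T -> R, continuous phi -> (exists M, forall q, `|phi q| <= M) ->
    (\int[mu N]_q (phi q)%:E)%E @[N --> \oo] --> (\int[nu]_q (phi q)%:E)%E.

Section MarkovChain.
Context (R : realType) (E : countType).

(* Standard honest transition function with Q-matrix [G]; the last clause
   covers the diagonal as well, hence also P_h -> identity as h -> 0+. *)
Definition transition_function (G : E -> E -> R) (P : R -> E -> E -> R) :=
  [/\ forall t x y, 0 <= t -> 0 <= P t x y,
      forall t x, 0 <= t -> \esum_(y in [set: E]) (P t x y)%:E = 1%E,
      forall s t x z, 0 <= s -> 0 <= t ->
        (P (s + t) x z)%:E = \esum_(y in [set: E]) (P s x y * P t y z)%:E,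
      forall x y, P 0 x y = (x == y)%:R &
      forall x y, (P h x y - (x == y)%:R) / h @[h --> 0^'+] --> G x y].

(* The initial law is unrestricted. In the Markov property, [past] ranges over
   the finite-dimensional cylinder events up to time s. *)
Definition markov_chain (d : measure_display) (Omega : measurableType d)
    (Pr : probability Omega R) (G : E -> E -> R) (X : R -> Omega -> E) :=
  (forall t x, 0 <= t -> measurable [set w | X t w = x]) /\
  exists2 P, transition_function G P &
    forall (past : seq (R * E)) s t x y,
      (forall p, p \in past -> 0 <= p.1 <= s) -> 0 <= s -> 0 <= t ->
      let H := [set w | (forall p, p \in past -> X p.1 w = p.2) /\ X s w = x] in
      Pr (H `&` [set w | X (s + t) w = y]) = (Pr H * (P t x y)%:E)%E.

End MarkovChain.

(* Capacities are [option nat], with [None] for infinity. *)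
Definition le_cap (k : nat) (B : option nat) : bool :=
  if B is Some b then (k <= b)%N else true.

Definition level (B : option nat) := {i : nat | (0 < i)%N && le_cap i B}.

Section OccupancySpace.
Context (R : realType) (B : option nat).

Definition occ_set : set {ptws level B -> R} :=
  [set q | (forall i, 0 <= q i <= 1) /\
           (forall i j : level B, val j = (val i).+1 -> q j <= q i)].

Definition occ_space : Type := set_type occ_set.

HB.instance Definition _ := Topological.on occ_space.

Lemma occ_set0 : occ_set (fun=> 0).
Proof. by split=> // i; rewrite lexx ler01. Qed.

HB.instance Definition _ := isPointed.Build occ_space (SigSub (mem_set occ_set0)).

End OccupancySpace.

Section JSQ.
Context (R : realType) (N : nat) (B : option nat).

Definition pool_state := {x : {ffun 'I_N -> nat} | [forall j, le_cap (x j) B]}.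

Definition tasks (x : pool_state) (j : 'I_N) : nat := val x j.

Definition occupancy (x : pool_state) (i : nat) : nat :=
  #|[pred j | (i <= tasks x j)%N]|.

Lemma fluid_subproof (x : pool_state) :
  occ_set (fun i : level B => (occupancy x (val i))%:R / N%:R : R).
Proof.
have le_occ i j : (i <= j)%N -> (occupancy x j <= occupancy x i)%N.
  move=> ij; apply/subset_leq_card/fintype.subsetP => k; rewrite !inE.
  exact: leq_trans.
split=> [i|i j ->]; last first.
  by rewrite ler_wpM2r ?invr_ge0 ?ler0n// ler_nat le_occ.
rewrite divr_ge0 ?ler0n//=; have [->|N0] := posnP N.
  by rewrite invr0 mulr0 ler01.
by rewrite ler_pdivrMr ?ltr0n// mul1r ler_nat -[leqRHS]card_ord max_card.
Qed.

Definition fluid_state (x : pool_state) : occ_space R B :=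
  SigSub (mem_set (fluid_subproof x)).

(* [tau x A j] is the probability that pool j is chosen when the arriving task
   finds state x and samples the set A of pools. *)
Definition tie_breaking_rule (tau : pool_state -> {set 'I_N} -> 'I_N -> R) :=
  forall x (A : {set 'I_N}), A != finset.set0 ->
    [/\ forall j, 0 <= tau x A j,
        \sum_j tau x A j = 1 &
        forall j, tau x A j != 0 ->
          j \in A /\ forall k, k \in A -> (tasks x j <= tasks x k)%N].

Context (lam : R) (d : nat) (tau : pool_state -> {set 'I_N} -> 'I_N -> R).

Definition assign_prob (x : pool_state) (j : 'I_N) : R :=
  (\sum_(A : {set 'I_N} | #|A| == d) tau x A j) / 'C(N, d)%:R.

Definition add_task (x : pool_state) (j : 'I_N) : {ffun 'I_N -> nat} :=
  [ffun k => (tasks x k + (k == j))%N].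

Definition remove_task (x : pool_state) (j : 'I_N) : {ffun 'I_N -> nat} :=
  [ffun k => (tasks x k - (k == j))%N].

(* The generator applied to the indicator of y, evaluated at x. An arrival
   assigned to a pool already holding B tasks is discarded: no transition. *)
Definition jsq_generator (x y : pool_state) : R :=
  \sum_(j | le_cap (tasks x j).+1 B)
     lam * assign_prob x j * ((add_task x j == val y)%:R - (x == y)%:R) +
  \sum_j (tasks x j)%:R * ((remove_task x j == val y)%:R - (x == y)%:R).

Definition jsq_process (dO : measure_display) (Omega : measurableType dO)
    (Pr : probability Omega R) (X : R -> Omega -> pool_state) :=
  markov_chain Pr jsq_generator X.

Definition stationary_occupancy_law (dO : measure_display)
    (Omega : measurableType dO) (Pr : probability Omega R)
    (X : R -> Omega -> pool_state)
    (pi : probability (borel (occ_space R B)) R) :=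
  pi (range fluid_state) = 1%E /\
  forall q : occ_space R B,
    Pr [set w | fluid_state (X t w) = q] @[t --> +oo] --> pi [set q].

End JSQ.

Section FixedPoint.
Context (R : realType) (B : option nat) (lambda : R).

Definition qstar_coord (i : nat) : R :=
  let K := Num.truncn lambda in
  if (i <= K)%N then 1 else if i == K.+1 then lambda - K%:R else 0.

Lemma qstar_subproof : 0 <= lambda ->
  occ_set (fun i : level B => qstar_coord (val i)).
Proof.
move=> l0; have /andP[Kl lK] := truncn_itv l0.
have f0 : 0 <= lambda - (Num.truncn lambda)%:R by rewrite subr_ge0.
have f1 : lambda - (Num.truncn lambda)%:R <= 1.
  by rewrite lerBlDl -natr1 in lK *; exact: ltW.
have q01 k : 0 <= qstar_coord k <= 1.
  rewrite /qstar_coord; case: ifP => _; first by rewrite ler01 lexx.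
  by case: ifP => _; rewrite ?f0 ?f1// lexx ler01.
split=> [i|i j ->]; first exact: q01.
case: (leqP (val i) (Num.truncn lambda)) => iK.
  by rewrite {2}/qstar_coord iK; case/andP: (q01 (val i).+1).
rewrite {1}/qstar_coord ltnNge (ltnW iK)/= eqSS gtn_eqF//.
by case/andP: (q01 (val i)).
Qed.

Definition qstar (lambda_ge0 : 0 <= lambda) : occ_space R B :=
  SigSub (mem_set (qstar_subproof lambda_ge0)).

End FixedPoint.

(* Main.v *)
Require Import Defs.
From mathcomp Require Import all_boot all_order all_algebra.
From mathcomp Require Import all_classical all_reals all_analysis.
From mathcomp Require Import measurable_realfun ring lra zify.
Set Implicit Arguments.
Unset Strict Implicit.
Unset Printing Implicit Defensive.
Import Order.TTheory GRing.Theory Num.Theory.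
Import numFieldNormedType.Exports.
Local Open Scope classical_set_scope.
Local Open Scope ring_scope.

(* Write K for the integer part of lambda, x_j for the number of tasks in pool j
   and q_i for the fraction of pools with at least i tasks. Instead of fluid
   limits, the argument uses one Lyapunov function on pool states,
     f = Z + A (V - lambda)^2 + W^2,
   where V, W and Z are the averages over the pools of x_j, (K - x_j)^+ and
   (x_j - K - 1)^+. The assigned pool holds at least i tasks with probability
   s_i <= q_i^d, whence (1 - q_i) s_i <= 1/d; this makes the terms by which the
   drifts of V, W and Z deviate from lambda - V, -W and -Z negligible, and the
   generator maps f to at most eps_N - f with
     eps_N = O(|lam N / N - lambda| + 1 / d N + 1 / N).
   Hence the limiting law gives mass at most eps_N / c to the set f >= c. A
   small f forces each q_i to be close to its limit, since 1 - q_i <= W for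
   i <= K, q_i <= Z for i >= K + 2 and
     q_(K+1) - (lambda - K) = (V - lambda) + W - Z. *)

(** * Auxiliary facts on finite sequences *)

Lemma near_in_seq (T : Type) (F : set_system T) (FF : Filter F) (J : eqType)
    (s : seq J) (Q : J -> T -> Prop) :
  (forall j, j \in s -> \forall t \near F, Q j t) ->
  \forall t \near F, forall j, j \in s -> Q j t.
Proof.
elim: s => [|j s IH] sQ; first by apply: nearW => t j; rewrite in_nil.
have Qj := sQ j (mem_head _ _).
have Qs : \forall t \near F, forall k, k \in s -> Q k t.
  by apply: IH => k ks; apply: sQ; rewrite in_cons ks orbT.
apply: filterS2 Qj Qs => t Qj Qs k.
by rewrite in_cons => /orP[/eqP ->//|/Qs].
Qed.

Lemma sum_uniq_le_esum (R : realType) (E : choiceType) (s : seq E)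
    (a : E -> \bar R) : uniq s -> (forall x, 0 <= a x)%E ->
  (\sum_(x <- s) a x <= \esum_(x in [set: E]) a x)%E.
Proof.
move=> us a0; apply: esum_ge; exists [set` s].
  by split=> //; exact: finite_seq.
by rewrite -fsbig_seq.
Qed.

Lemma sum_seq_indic (R : pzRingType) (E : eqType) (s : seq E) (z : E)
    (g : E -> R) : uniq s ->
  \sum_(y <- s) (z == y)%:R * g y = (z \in s)%:R * g z.
Proof.
move=> us; have [zs|zs] := boolP (z \in s).
  rewrite (bigD1_seq z)//= eqxx mul1r big1 ?addr0 ?mul1r// => y.
  by rewrite eq_sym => /negPf ->; rewrite mul0r.
rewrite mul0r big_seq big1// => y ys.
by case: eqP => [zy|]; rewrite ?mul0r//; rewrite zy ys in zs.
Qed.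

(** * Jump generators and short-time asymptotics *)

Section JumpGenerator.
Context (R : realType) (E : countType) (I : finType).
Context (r : I -> E -> R) (J : I -> E -> E).

(** Jumps are indexed by a finite type, each with a rate and a target, so the generator acts by a
    finite sum even on unbounded [g] over an infinite state space. *)
Definition drift (g : E -> R) (x : E) : R :=
  \sum_i r i x * (g (J i x) - g x).

Lemma driftD g h x : drift (fun y => g y + h y) x = drift g x + drift h x.
Proof.
rewrite /drift -big_split/=; apply: eq_bigr => i _; ring.
Qed.

Lemma driftZ a g x : drift (fun y => a * g y) x = a * drift g x.
Proof. by rewrite /drift big_distrr/=; apply: eq_bigr => i _; ring. Qed.

(** The last sum is the quadratic variation rate of [g]; it comes from (b - c)^2 - (a - c)^2 = 2 (a
    - c) (b - a) + (b - a)^2. *)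
Lemma drift_sqr g c x : drift (fun y => (g y - c) ^+ 2) x =
  2 * (g x - c) * drift g x + \sum_i r i x * (g (J i x) - g x) ^+ 2.
Proof.
rewrite /drift big_distrr/= -big_split/=; apply: eq_bigr => i _; ring.
Qed.

Hypothesis r_ge0 : forall i x, 0 <= r i x.
Context (G : E -> E -> R) (P : R -> E -> E -> R).
Hypothesis G_jump : forall x y,
  G x y = \sum_i r i x * ((J i x == y)%:R - (x == y)%:R).
Hypothesis trP : transition_function G P.

(** The row of [G] at [x] vanishes off [x] and its targets, so a finite [s] containing these
    captures the whole generator. *)
Lemma sum_generator (s : seq E) g x : uniq s -> x \in s ->
  (forall i, J i x \in s) -> \sum_(y <- s) G x y * g y = drift g x.
Proof.
move=> us xs Js.
under eq_bigr do rewrite G_jump big_distrl/=.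
rewrite exchange_big/=; apply: eq_bigr => i _.
under eq_bigr do rewrite -mulrA mulrBl.
by rewrite -big_distrr/= sumrB !sum_seq_indic// xs Js !mul1r.
Qed.

(* Both sides are compared through 1 - g: its expectation is bounded below by
   the contribution of the finitely many states reachable in one jump, so that
   the estimate is uniform in g. *)
Lemma transition_near0 x eta : 0 < eta ->
  \forall h \near 0^'+, forall g : E -> R, (forall y, 0 <= g y <= 1) ->
  (\esum_(y in [set: E]) (P h x y * g y)%:E <=
     (g x + h * (drift g x + eta))%:E)%E.
Proof.
move=> eta0; have [P0 P1 _ _ PG] := trP.
pose s := undup (x :: [seq J i x | i <- enum I]).
have us : uniq s by exact: undup_uniq.
have xs : x \in s by rewrite mem_undup mem_head.
have Js i : J i x \in s.
  by rewrite mem_undup in_cons map_f ?orbT// mem_enum.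
have n0 : 0 < (size s)%:R :> R by rewrite ltr0n; case: (s) xs.
have e0 : 0 < eta / (size s)%:R by rewrite divr_gt0.
have nearP : \forall h \near 0^'+, forall y, y \in s ->
    `|(P h x y - (x == y)%:R) / h - G x y| <= eta / (size s)%:R.
  apply: near_in_seq => y _; near=> h; rewrite distrC; near: h.
  exact: cvgr_dist_le (PG x y) _ e0.
near=> h; move=> g g01.
have h0 : 0 < h by near: h; exact: nbhs_right_gt.
have Pnear y : y \in s ->
    `|(P h x y - (x == y)%:R) / h - G x y| <= eta / (size s)%:R.
  by move: y; near: h.
have Ph0 y : 0 <= P h x y by exact/P0/ltW.
have Pg0 y : (0 <= (P h x y * g y)%:E)%E.
  by rewrite lee_fin mulr_ge0//; case/andP: (g01 y).
have Pg'0 y : (0 <= (P h x y * (1 - g y))%:E)%E.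
  by rewrite lee_fin mulr_ge0// subr_ge0; case/andP: (g01 y).
have := P1 h x (ltW h0).
under eq_esum => y _.
  rewrite (_ : (P h x y)%:E = (P h x y * g y)%:E + (P h x y * (1 - g y))%:E)%E.
  over.
  by rewrite -EFinD; congr _%:E; ring.
rewrite esumD//= => Psum.
have Pgle : (\esum_(y in [set: E]) (P h x y * g y)%:E +
    (\sum_(y <- s) P h x y * (1 - g y))%:E <= 1)%E.
  rewrite -Psum leeD2l// -sumEFin; exact: sum_uniq_le_esum.
(* For [y] in [s], [P h x y] is within h eta / size s of (x == y) + h G x y, and 1 - g <= 1, so the
   errors add up to at most h eta. *)
have low : 1 - g x - h * (drift g x + eta) <=
    \sum_(y <- s) P h x y * (1 - g y).
  have -> : 1 - g x - h * (drift g x + eta) =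
      \sum_(y <- s) ((x == y)%:R * (1 - g y) + h * (G x y * (1 - g y)) -
        h * (eta / (size s)%:R)).
    rewrite sumrB big_split/= sum_seq_indic// xs mul1r -big_distrr/=.
    rewrite sum_generator// big_const_seq iter_addr_0 count_predT.
    have -> : (h * (eta / (size s)%:R)) *+ size s = h * eta.
      by rewrite -[LHS]mulr_natr -mulrA mulfVK ?gt_eqF.
    have -> : drift (fun y => 1 - g y) x = - drift g x.
      by rewrite /drift -sumrN; apply: eq_bigr => i _; ring.
    ring.
  rewrite big_seq [leRHS]big_seq; apply: ler_sum => y ys.
  move: (Pnear y ys).
  set a := (_ / h) - _ => ale.
  have -> : P h x y = (x == y)%:R + h * (G x y + a).
    rewrite /a addrCA subrr addr0 mulrCA divff ?gt_eqF//; ring.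
  have /andP[g0 g1] := g01 y.
  have : - (eta / (size s)%:R) <= a * (1 - g y).
    rewrite lerNl -mulNr; apply: le_trans (ler_norm _) _.
    rewrite normrM normrN ger0_norm ?subr_ge0// (le_trans _ ale)//.
    by rewrite ler_piMr// gerBl.
  move=> /(ler_wpM2l (ltW h0)) => H.
  rewrite -subr_ge0; move: H; rewrite -subr_ge0; congr (_ <= _); ring.
have fin : (\esum_(y in [set: E]) (P h x y * g y)%:E)%E \is a fin_num.
  rewrite ge0_fin_numE; last by apply: esum_ge0 => y _.
  apply: (@le_lt_trans _ _ 1%E); last exact: ltry.
  rewrite -Psum leeDl//; exact: esum_ge0.
move: Pgle; rewrite -(fineK fin) -EFinD !lee_fin; lra.
Unshelve. all: by end_near.
Qed.

Lemma transition_le1 t x (s : seq E) : 0 <= t -> uniq s ->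
  \sum_(z <- s) P t x z <= 1.
Proof.
move=> t0 us; have [P0 P1 _ _ _] := trP.
rewrite -lee_fin -sumEFin -(P1 t x t0); apply: sum_uniq_le_esum => // z.
by rewrite lee_fin P0.
Qed.

(** Used with a first step [t] = h: the probability of ending in [s] becomes the expectation of a
    function of the state after that step. *)
Lemma transitionD t u x (s : seq E) : 0 <= t -> 0 <= u ->
  (\sum_(z <- s) P (t + u) x z)%:E =
  \esum_(y in [set: E]) (P t x y * \sum_(z <- s) P u y z)%:E.
Proof.
move=> t0 u0; have [P0 _ PD _ _] := trP.
rewrite -sumEFin; under eq_bigr do rewrite PD//.
rewrite -esum_sum; last by move=> *; rewrite lee_fin mulr_ge0// P0.
by apply: eq_esum => y _; rewrite sumEFin big_distrr.
Qed.

(* Time is discretized with step h. A step needs the short-time estimate only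
   where f is at most expR (2 t), i.e. at finitely many states; elsewhere the
   claimed bound exceeds 1. *)
Lemma foster_lyapunov (f : E -> R) (eps : R) :
  0 <= eps -> (forall x, 0 <= f x) -> (forall x, drift f x <= eps - f x) ->
  (forall M, finite_set [set x | f x <= M]) ->
  forall (s : seq E), uniq s -> (forall z, z \in s -> 1 <= f z) ->
  forall t x, 0 <= t -> \sum_(z <- s) P t x z <= expR (- t) * f x + eps.
Proof.
move=> eps0 f0 df ffin s us fs t x; have [P0 P1 _ P00 _] := trP.
have init y : \sum_(z <- s) P 0 y z <= f y.
  have -> : \sum_(z <- s) P 0 y z = \sum_(z <- s) (y == z)%:R * 1.
    by apply: eq_bigr => z _; rewrite P00 mulr1.
  rewrite (sum_seq_indic y (fun=> 1))// mulr1.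
  by have [/fs|] := boolP (y \in s).
rewrite le_eqVlt => /predU1P[<-|t0].
  by rewrite oppr0 expR0 mul1r (le_trans (init x))// lerDl.
apply/ler_addgt0Pr => delta delta0.
(* A lower bound for every (1 - h)^k with h = t / n <= 1/2 and k <= n, since then 1 - h >= expR (- 2
   h). *)
pose a0 : R := expR (- (2 * t)).
have a0_gt0 : 0 < a0 by exact: expR_gt0.
have [F FE] := (finite_seqP _).1 (ffin a0^-1).
(* The error rate [delta * a0] is at most delta (1 - h)^k at step k, so the errors sum to at most
   delta. The second clause makes g y + h drift g y a combination of values of [g] with nonnegative
   weights, hence monotone in [g]. *)
pose step (h : R) := forall y, y \in F ->
  (forall g : E -> R, (forall z, 0 <= g z <= 1) ->
    (\esum_(z in [set: E]) (P h y z * g z)%:E <=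
       (g y + h * (drift g y + delta * a0))%:E)%E) /\
  h * \sum_i r i y <= 1.
have : \forall h \near 0^'+, step h.
  apply: near_in_seq => y yF; apply: filterS2.
  - by move=> h A B; split; [exact: A|exact: B].
  - by apply: transition_near0; rewrite mulr_gt0.
  - have S0 : 0 < 1 + \sum_i r i y by rewrite ltr_wpDr ?sumr_ge0.
    near=> h; rewrite (@le_trans _ _ ((1 + \sum_i r i y)^-1 * \sum_i r i y))//.
      by rewrite ler_wpM2r ?sumr_ge0//; near: h; apply: nbhs_right_le; rewrite invr_gt0.
    by rewrite mulrC ler_pdivrMr// mul1r lerDr.
case=> e /= e0 He.
(* For h = t / n this gives both h < e, so that [step h] holds, and h <= 1/2. *)
pose n := (Num.truncn (t / e + 2 * t)).+1.
have n_gt : t / e + 2 * t < n%:R by exact: truncnS_gt.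
have n0 : 0 < n%:R :> R by [].
pose h := t / n%:R.
have h0 : 0 < h by rewrite divr_gt0.
have te0 : 0 < t / e by rewrite divr_gt0.
have h_half : h <= 2^-1.
  by rewrite ler_pdivrMr// mulrC ler_pdivlMr// mulrC; lra.
have h_step : step h.
  apply: He => //=; rewrite sub0r normrN gtr0_norm// ltr_pdivrMr// mulrC.
  rewrite -ltr_pdivrMr//; lra.
have hn : h * n%:R = t by rewrite mulfVK ?gt_eqF.
have a_ge k : (k <= n)%N -> a0 <= (1 - h) ^+ k.
  move=> kn; apply: (@le_trans _ _ ((1 - h) ^+ n)); last first.
    by apply: ler_wiXn2l => //; lra.
  have -> : a0 = expR (- (2 * h)) ^+ n.
    by rewrite -expRM_natr /a0 -hn; congr expR; ring.
  apply: lerXn2r; rewrite ?nnegrE ?expR_ge0//; first lra.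
  rewrite expRN -[leRHS]invrK lef_pV2 ?posrE ?invr_gt0 ?expR_gt0//; last lra.
  apply: le_trans (expR_ge1Dx _).
  by rewrite -[leLHS]mul1r ler_pdivrMr; [nra|lra].
have a_le1 k : (1 - h) ^+ k <= 1 by apply: exprn_ile1; lra.
(* With a = (1 - h)^k, one more step adds at most h a (eps - f y) from the drift and h a delta from
   the error, which is exactly the change of the bound from k to k + 1. *)
have bound k : (k <= n)%N -> forall y, \sum_(z <- s) P (h * k%:R) y z <=
    (1 - h) ^+ k * f y + (eps + delta) * (1 - (1 - h) ^+ k).
  elim: k => [|k IH] kn y.
    by rewrite mulr0 expr0 mul1r subrr mulr0 addr0.
  pose u y := \sum_(z <- s) P (h * k%:R) y z.
  have hk0 : 0 <= h * k%:R by rewrite mulr_ge0// ltW.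
  have u01 z : 0 <= u z <= 1.
    by rewrite transition_le1// sumr_ge0// => w _; rewrite P0.
  have uf : forall z, u z <= _ := IH (ltnW kn).
  have aS := a_ge _ kn; have ak := a_ge _ (ltnW kn); have ak1 := a_le1 k.
  set a := (1 - h) ^+ k in uf ak ak1 *.
  have [fy|fy] := leP (f y) a0^-1; last first.
    apply: (@le_trans _ _ 1); first by apply: transition_le1 => //; rewrite mulr_ge0// ltW.
    apply: (@le_trans _ _ ((1 - h) ^+ k.+1 * f y)).
      rewrite -[leLHS](mulfV (lt0r_neq0 a0_gt0)) ler_pM ?a_ge// ?ltW//.
      by rewrite invr_gt0.
    by rewrite lerDl mulr_ge0 ?subr_ge0// addr_ge0// ltW.
  have yF : y \in F by have : [set z | f z <= a0^-1] y := fy; rewrite FE.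
  have [Pg hr] := h_step y yF.
  have -> : h * k.+1%:R = h + h * k%:R by rewrite -natr1; ring.
  rewrite -lee_fin transitionD ?(ltW h0)//.
  apply: le_trans (Pg u u01) _; rewrite lee_fin.
  have du : u y + h * drift u y <= a * f y + (eps + delta) * (1 - a) +
      h * (a * drift f y).
    pose v z := a * f z + (eps + delta) * (1 - a).
    have -> : a * drift f y = drift v y.
      by rewrite -driftZ /drift; apply: eq_bigr => i _; rewrite /v; ring.
    have split_drift g : g y + h * drift g y =
        (1 - h * \sum_i r i y) * g y + h * \sum_i r i y * g (J i y).
      rewrite /drift; under eq_bigr do rewrite mulrBr.
      rewrite sumrB -big_distrl/=; ring.
    rewrite -[X in _ <= X + _]/(v y) !split_drift.
    apply: lerD; first by apply: ler_wpM2l; [rewrite subr_ge0|exact: uf].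
    apply: ler_wpM2l (ltW h0) _ _ _; apply: ler_sum => i _.
    by apply: ler_wpM2l => //; exact: uf.
  have := df y; rewrite exprS -/a.
  have : h * (a * drift f y) <= h * (a * (eps - f y)).
    by rewrite !ler_wpM2l// ltW// (lt_le_trans a0_gt0).
  have : h * (delta * a0) <= h * (delta * a) by rewrite !ler_wpM2l// ltW.
  have := f0 y; lra.
have := bound n (leqnn n) x; rewrite hn => /le_trans; apply.
have anexp : (1 - h) ^+ n <= expR (- t).
  have -> : - t = - h * n%:R by rewrite mulNr hn.
  rewrite expRM_natr; apply: lerXn2r; rewrite ?nnegrE ?expR_ge0//; first lra.
  exact: expR_ge1Dx.
rewrite -addrA lerD ?ler_wpM2r// ler_piMr//; first by rewrite addr_ge0// ltW.
by rewrite gerBl (le_trans (ltW a0_gt0))// a_ge.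
Unshelve. all: by end_near.
Qed.

End JumpGenerator.

Lemma measure_bigcup_seq (d : measure_display) (T : measurableType d)
    (R : realType) (mu : {measure set T -> \bar R}) (E : choiceType)
    (A : E -> set T) (s : seq E) :
  (forall x, measurable (A x)) -> uniq s -> trivIset setT A ->
  mu (\bigcup_(x in [set` s]) A x) = (\sum_(x <- s) mu (A x))%E.
Proof.
move=> mA us tA; rewrite bigcup_seq (fsbig_seq _ _ us) measure_fsbig//.
- by rewrite -fsbig_seq.
- by move=> x y _ _; exact: tA.
Qed.

(** * Stationary bounds for Markov chains *)

Section CountableUnion.
Context (d : measure_display) (T : measurableType d) (R : realType).
Context (E : countType) (A : E -> set T).
Hypothesis mA : forall x, measurable (A x).

Lemma measurable_bigcup_count (D : set E) : measurable (\bigcup_(x in D) A x).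
Proof.
rewrite bigcup_mkcond; apply: countable_bigcupT_measurable => //.
by move=> x; case: ifP.
Qed.

(** Continuity from below along the finite sets of elements of [D] whose code is less than n. *)
Lemma measure_bigcup_count_le (mu : {measure set T -> \bar R}) (D : set E)
    (b : \bar R) :
  (forall s : seq E, uniq s -> [set` s] `<=` D ->
    (mu (\bigcup_(x in [set` s]) A x) <= b)%E) ->
  (mu (\bigcup_(x in D) A x) <= b)%E.
Proof.
move=> sb.
pose s n := undup [seq x <- pmap (@pickle_inv E) (iota 0 n) | `[< D x >]].
have sE n x : x \in s n <-> D x /\ (pickle x < n)%N.
  rewrite mem_undup mem_filter mem_pmap; split.
    move=> /andP[/asboolP Dx /mapP[k]]; rewrite mem_iota/= add0n => kn xk.
    by split=> //; move: (@pickle_invK E k); rewrite -xk/= => ->.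
  move=> [Dx xn]; apply/andP; split; first exact/asboolP.
  by apply/mapP; exists (pickle x); rewrite ?mem_iota// pickleK_inv.
have -> : \bigcup_(x in D) A x = \bigcup_n \bigcup_(x in [set` s n]) A x.
  apply/seteqP; split=> w.
    by move=> [x Dx Ax]; exists (pickle x).+1 => //; exists x => //; apply/sE.
  by move=> [n _ [x /sE[Dx _] Ax]]; exists x.
have := @nondecreasing_cvg_mu _ _ _ mu (fun n => \bigcup_(x in [set` s n]) A x).
move=> /(_ _ _ _)/cvge_to_le; apply.
- by move=> n; exact: measurable_bigcup_count.
- by apply: bigcup_measurable => n _; exact: measurable_bigcup_count.
- move=> m n mn; apply/subsetPset => w [x /sE[Dx xm] Ax]; exists x => //.
  by apply/sE; split=> //; exact: leq_trans mn.
- apply: nearW => n /=; apply: sb; first exact: undup_uniq.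
  by move=> x /sE[].
Qed.

End CountableUnion.

Section MarkovChainLaw.
Context (R : realType) (E : countType) (G : E -> E -> R).
Context (d : measure_display) (Omega : measurableType d).
Context (Pr : probability Omega R) (X : R -> Omega -> E).

(** [f] need not be integrable under the initial law: a finite set of initial states carries mass
    above 1 - delta / 2, and on it expR (- t) f tends to 0 uniformly. *)
Lemma markov_chain_tail (P : R -> E -> E -> R) (D : set E) (f : E -> R)
    (eps : R) :
  (forall t x, 0 <= t -> measurable [set w | X t w = x]) ->
  (forall t x y, 0 <= t ->
    Pr ([set w | X 0 w = x] `&` [set w | X t w = y]) =
      (Pr [set w | X 0 w = x] * (P t x y)%:E)%E) ->
  0 <= eps -> (forall x, 0 <= f x) ->
  (forall s : seq E, uniq s -> [set` s] `<=` D -> forall t x, 0 <= t ->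
    \sum_(z <- s) P t x z <= expR (- t) * f x + eps) ->
  forall delta, 0 < delta ->
  \forall t \near +oo,
    (Pr (\bigcup_(z in D) [set w | X t w = z]) <= (eps + delta)%:E)%E.
Proof.
move=> mX PX eps0 f0 Pf delta delta0.
have tX t : trivIset [set: E] (fun z => [set w | X t w = z]).
  by move=> x y _ _ [w [/= -> ->]].
have [s us Prs] : exists2 s : seq E, uniq s &
    ((1 - delta / 2)%:E < Pr (\bigcup_(x in [set` s]) [set w | X 0%R w = x]))%E.
  (* Otherwise all finite sets of initial states, hence also their union, would have mass at most 1
     - delta / 2. *)
  apply: contrapT => nos.
  have : (Pr (\bigcup_(x in [set: E]) [set w | X 0%R w = x]) <=
      (1 - delta / 2)%:E)%E.
    apply: measure_bigcup_count_le => [x|s us _]; first exact: mX.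
    by rewrite leNgt; apply/negP => ?; apply: nos; exists s.
  rewrite [X in Pr X](_ : _ = setT).
    by rewrite probability_setT lee_fin; lra.
  by apply/seteqP; split=> // w _; exists (X 0 w).
pose A := \bigcup_(x in [set` s]) [set w | X 0 w = x].
have mA : measurable A by apply: measurable_bigcup_count => x; exact: mX.
have PrA : (Pr (~` A) <= (delta / 2)%:E)%E.
  have PrE : Pr A = (fine (Pr A))%:E by rewrite fineK// fin_num_measure.
  move: Prs; rewrite -/A probability_setC// PrE -EFinB lee_fin lte_fin; lra.
pose m := \sum_(x <- s) f x.
have m0 : 0 <= m by rewrite sumr_ge0.
near=> t.
have t0 : 0 < t by near: t; exact: nbhs_pinfty_gt.
apply: measure_bigcup_count_le => [z|z uz zD]; first by apply/mX/ltW.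
pose C := \bigcup_(y in [set` z]) [set w | X t w = y].
have mC : measurable C by apply: measurable_bigcup_count => y; apply/mX/ltW.
have mAC x : measurable ([set w | X 0 w = x] `&` C).
  by apply: measurableI => //; exact: mX.
have C_split : C `<=` (~` A) `|`
    \bigcup_(x in [set` s]) ([set w | X 0 w = x] `&` C).
  move=> w Cw; have [[x sx Xx]|] := pselect (A w); last by left.
  by right; exists x.
have mB : measurable (\bigcup_(x in [set` s]) ([set w | X 0 w = x] `&` C)).
  exact: measurable_bigcup_count.
apply: (@le_trans _ _ (Pr (~` A) +
    Pr (\bigcup_(x in [set` s]) ([set w | X 0%R w = x] `&` C)))%E).
  apply: le_trans (measureU2 _ _ _) => //; last exact: measurableC.
  by apply: le_measure; rewrite ?inE//; apply: measurableU => //; exact: measurableC.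
(* The Markov property from time 0, summed over the disjoint final states in [z]. *)
have PrAC x : Pr ([set w | X 0 w = x] `&` C) =
    (Pr [set w | X 0%R w = x] * (\sum_(y <- z) P t x y)%:E)%E.
  rewrite /C setI_bigcupr measure_bigcup_seq//; last first.
  - apply: trivIset_setIl; exact: tX.
  - by move=> y; apply: measurableI; [exact: mX|apply/mX/ltW].
  rewrite (eq_bigr (fun y => (Pr [set w | X 0%R w = x] * (P t x y)%:E)%E)).
    rewrite -sumEFin -(fineK (fin_num_measure Pr _ (mX 0 x (lexx 0)))).
    under eq_bigr do rewrite -EFinM.
    by rewrite !sumEFin -EFinM big_distrr.
  by move=> y _; rewrite [LHS]PX// ltW.
rewrite measure_bigcup_seq//; last exact/trivIset_setIr/tX.
have -> : (eps + delta)%:E = ((delta / 2)%:E + (delta / 2 + eps)%:E)%E.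
  by rewrite -EFinD; congr _%:E; lra.
apply: leeD => //.
pose p x := fine (Pr [set w | X 0 w = x]).
have pE x : Pr [set w | X 0 w = x] = (p x)%:E.
  by rewrite fineK// fin_num_measure//; exact: mX.
have p0 x : 0 <= p x by rewrite fine_ge0.
have p1 x : p x <= 1.
  by rewrite -lee_fin -pE probability_le1//; exact: mX.
have sum_p : \sum_(x <- s) p x <= 1.
  rewrite -lee_fin -sumEFin; under eq_bigr do rewrite -pE.
  by rewrite -measure_bigcup_seq//; [exact: probability_le1|move=> x; exact: mX].
rewrite (eq_bigr (fun x => (p x * \sum_(y <- z) P t x y)%:E)); last first.
  by move=> x _; rewrite [LHS]PrAC pE EFinM.
rewrite sumEFin lee_fin.
apply: (@le_trans _ _ (\sum_(x <- s) (expR (- t) * f x + p x * eps))).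
  apply: ler_sum => x _.
  apply: (@le_trans _ _ (p x * (expR (- t) * f x + eps))).
    by apply: ler_wpM2l => //; apply: Pf => //; exact: ltW.
  rewrite mulrDr lerD2r ler_piMl//.
  by rewrite mulr_ge0// expR_ge0.
rewrite big_split/= -big_distrr -big_distrl/= -/m.
apply: lerD; last by rewrite ler_piMl.
(* A crude decay suffices: it leaves the condition t >= m / (delta / 2). *)
have : expR (- t) <= t^-1.
  rewrite expRN lef_pV2 ?posrE ?expR_gt0//.
  by apply: le_trans (expR_ge1Dx _); rewrite lerDr.
move=> /(ler_wpM2r m0)/le_trans; apply.
rewrite mulrC ler_pdivrMr// mulrC -ler_pdivrMr; last by rewrite divr_gt0.
near: t; apply: nbhs_pinfty_ge; exact: num_real.
Unshelve. all: by end_near.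
Qed.

(** [mu] is reached only through limits of point probabilities, so the tail bound passes first to
    finite subsets of [U], then to [U], which is countable as a part of the range of [F]. The map
    [F] is there because the chain lives on pool states and the limiting law on occupancy states. *)
Lemma stationary_foster_lyapunov (I : finType) (r : I -> E -> R)
    (J : I -> E -> E) (f : E -> R) (eps : R) :
  (forall i x, 0 <= r i x) ->
  (forall x y, G x y = \sum_i r i x * ((J i x == y)%:R - (x == y)%:R)) ->
  markov_chain Pr G X ->
  0 <= eps -> (forall x, 0 <= f x) -> (forall x, drift r J f x <= eps - f x) ->
  (forall M, finite_set [set x | f x <= M]) ->
  forall (d' : measure_display) (V : measurableType d')
    (mu : {measure set V -> \bar R}) (F : E -> V) (U : set V),
  (forall v : V, d'.-measurable [set v]) ->
  (forall v : V, Pr [set w | F (X t w) = v] @[t --> +oo] --> mu [set v]) ->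
  U `<=` range F -> (forall x, U (F x) -> 1 <= f x) ->
  (mu U <= eps%:E)%E.
Proof.
move=> r0 GJ [mX [P trP PX]] eps0 f0 df ffin d' V mu F U mV muF UF Uf.
have -> : U = \bigcup_(x in F @^-1` U) [set F x].
  apply/seteqP; split=> [v Uv|v [x UFx ->]//].
  by have [x _ Fx] := UF _ Uv; exists x => //=; rewrite Fx.
apply: measure_bigcup_count_le => [x|s us sU]; first exact: mV.
have tF : trivIset [set: V] (fun v => [set v]).
  by move=> v v' _ _ [u [/= -> ->]].
pose vs := undup (map F s).
have -> : \bigcup_(x in [set` s]) [set F x] = \bigcup_(v in [set` vs]) [set v].
  apply/seteqP; split=> v /=.
    by move=> [x sx ->]; exists (F x) => //=; rewrite mem_undup map_f.
  move=> [u] /=; rewrite mem_undup => /mapP[x xs ->] ->; by exists x.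
have mFX v t : 0 <= t -> measurable [set w | F (X t w) = v].
  move=> t0; rewrite (_ : [set w | _] =
      \bigcup_(x in F @^-1` [set v]) [set w | X t w = x]).
    by apply: measurable_bigcup_count => x; exact: mX.
  apply/seteqP; split=> [w Fw|w [x /= Fx Xx]]; first by exists (X t w).
  by rewrite Xx.
rewrite measure_bigcup_seq ?undup_uniq//.
apply/lee_addgt0Pr => delta delta0; rewrite -EFinD.
have : \sum_(v <- vs) Pr [set w | F (X t w) = v] @[t --> +oo] -->
    (\sum_(v <- vs) mu [set v])%E.
  by apply: cvg_nnesum => v _ //; apply: nearW => t; exact: measure_ge0.
move/cvge_to_le; apply.
have PX0 t x y : 0 <= t -> Pr ([set w | X 0 w = x] `&` [set w | X t w = y]) =
    (Pr [set w | X 0%R w = x] * (P t x y)%:E)%E.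
  move=> t0; have past0 (p : R * E) : p \in [::] -> 0 <= p.1 <= 0 by [].
  (* An empty past leaves the joint law at times 0 and t. *)
  have /= := PX [::] 0 t x y past0 (lexx 0) t0.
  suff -> : [set w | (forall p : R * E, p \in [::] -> X p.1 w = p.2) /\
      X 0 w = x] = [set w | X 0 w = x] by rewrite add0r.
  by apply/seteqP; split=> [w []|w].
have tail : \forall t \near +oo,
    (Pr (\bigcup_(x in F @^-1` U) [set w | X t w = x]) <= (eps + delta)%:E)%E.
  apply: (markov_chain_tail mX PX0 eps0 f0 _ delta0) => s' us' sU' t x t0.
  by apply: (foster_lyapunov r0 GJ trP) => // z zs; apply/Uf/sU'.
near=> t.
have t0 : 0 <= t by near: t; apply: nbhs_pinfty_ge; exact: num_real.
rewrite -measure_bigcup_seq ?undup_uniq//; last 2 first.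
- by move=> v; exact: mFX.
- by move=> v v' _ _ [w [/= -> ->]].
have mX' (D : set E) : measurable (\bigcup_(x in D) [set w | X t w = x]).
  by apply: measurable_bigcup_count => x; exact: mX.
apply: (@le_trans _ _
    (Pr (\bigcup_(x in F @^-1` U) [set w | X t w = x]))).
  apply: le_measure; rewrite ?inE//.
    by apply: fin_bigcup_measurable => // v _; exact: mFX.
  move=> w [v] /=; rewrite mem_undup => /mapP[x xs ->] Fw.
  by exists (X t w) => //=; rewrite Fw; exact: sU.
by near: t; exact: tail.
Unshelve. all: by end_near.
Qed.

End MarkovChainLaw.

(** * The JSQ(d) generator *)

(** With q^n added, the left side equals 1 at n = 0 and is nonincreasing in n: the decrement is (n +
    1) q^n (1 - q)^2. *)
Lemma exprn_onem_le (R : realFieldType) (q : R) (n : nat) :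
  0 <= q <= 1 -> n%:R * q ^+ n * (1 - q) <= 1.
Proof.
move=> /andP[q0 q1].
suff : n%:R * q ^+ n * (1 - q) + q ^+ n <= 1.
  by apply: le_trans; rewrite lerDl exprn_ge0.
elim: n => [|n IH]; first by rewrite !mul0r add0r expr0.
apply: le_trans IH; rewrite exprS -natr1.
have n0 : 0 <= n%:R * q ^+ n * (1 - q).
  by rewrite !mulr_ge0 ?exprn_ge0 ?subr_ge0.
have qn0 : 0 <= q ^+ n * (1 - q) by rewrite mulr_ge0 ?exprn_ge0 ?subr_ge0.
rewrite -subr_ge0; set a := _ * q ^+ n * _ in n0.
have -> : a + q ^+ n - ((n%:R + 1) * (q * q ^+ n) * (1 - q) + q * q ^+ n) =
    (a + q ^+ n * (1 - q)) * (1 - q) by rewrite /a; ring.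
by apply: mulr_ge0; [exact: addr_ge0|rewrite subr_ge0].
Qed.

(** Factor by factor, (m - i) n <= (n - i) m. This compares sampling without replacement to sampling
    with replacement. *)
Lemma bin_mul_expn_le (m n k : nat) : (m <= n)%N ->
  ('C(m, k) * n ^ k <= 'C(n, k) * m ^ k)%N.
Proof.
move=> mn; rewrite -(leq_pmul2r (fact_gt0 k)) mulnAC bin_ffact.
rewrite mulnAC bin_ffact; elim: k => [//|k IH].
rewrite !ffactnSr !expnSr mulnACA [leqRHS]mulnACA leq_mul//.
by rewrite mulnBl [leqRHS]mulnBl [(m * n)%N]mulnC leq_sub2l// leq_mul2l mn orbT.
Qed.

Lemma le_capW (m n : nat) (B : option nat) :
  (m <= n)%N -> le_cap n B -> le_cap m B.
Proof. by case: B => //= b; exact: leq_trans. Qed.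

(** * Pool averages and the Lyapunov function *)

Section PoolState.
Context (R : realType) (N : nat) (B : option nat).
Hypothesis N_gt0 : (0 < N)%N.
Implicit Types (x y : pool_state N B) (j k : 'I_N) (h : nat -> R).

Let N0 : 0 < N%:R :> R. Proof. by rewrite ltr0n. Qed.

Local Notation q x i := ((occupancy x i)%:R / N%:R : R).

Lemma tasks_le_cap x j : le_cap (tasks x j) B.
Proof. exact: (forallP (valP x) j). Qed.

(** Each of q_i, V, W and Z has this form, which reduces relations between them to relations between
    functions of one task count. *)
Definition pool_mean h x : R := (\sum_j h (tasks x j)) / N%:R.

Lemma pool_mean_le h h' x : (forall n, h n <= h' n) ->
  pool_mean h x <= pool_mean h' x.
Proof. by move=> hh; rewrite ler_wpM2r ?invr_ge0// ler_sum. Qed.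

Lemma pool_meanD h h' x :
  pool_mean (fun n => h n + h' n) x = pool_mean h x + pool_mean h' x.
Proof. by rewrite -mulrDl -big_split. Qed.

Lemma pool_meanZ c h x : pool_mean (fun n => c * h n) x = c * pool_mean h x.
Proof. by rewrite /pool_mean -big_distrr/= mulrA. Qed.

Lemma pool_mean_cst c x : pool_mean (fun=> c) x = c.
Proof.
by rewrite /pool_mean sumr_const card_ord -[c *+ N]mulr_natr mulfK// gt_eqF.
Qed.

Lemma pool_mean_ge0 h x : (forall n, 0 <= h n) -> 0 <= pool_mean h x.
Proof. by move=> h0; rewrite divr_ge0// sumr_ge0. Qed.

Lemma occupancy_frac01 x i : 0 <= q x i <= 1.
Proof.
rewrite divr_ge0//= ler_pdivrMr// mul1r ler_nat -[leqRHS]card_ord.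
exact: max_card.
Qed.

Lemma occupancy_mean x i : q x i = pool_mean (fun n => (i <= n)%:R) x.
Proof.
rewrite /pool_mean /occupancy -sum1_card natr_sum big_mkcond/=.
by congr (_ / _); apply: eq_bigr => j _; rewrite inE; case: leqP.
Qed.

(** V, W and Z of the overview; truncated subtraction supplies the positive parts. *)
Definition mean_tasks x : R := pool_mean (fun n => n%:R) x.
Definition shortfall (K : nat) x : R := pool_mean (fun n => (K - n)%:R) x.
Definition excess (K : nat) x : R := pool_mean (fun n => (n - K.+1)%:R) x.

(** Markov's inequality for the empirical distribution of the task counts. *)
Lemma mean_tasks_ge x i : i%:R * q x i <= mean_tasks x.
Proof.
rewrite occupancy_mean -pool_meanZ; apply: pool_mean_le => n.
by case: leqP => [ni|_]; rewrite ?mulr1 ?mulr0 ?ler_nat.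
Qed.

Lemma shortfall_le K x : shortfall K x <= K%:R * (1 - q x K).
Proof.
rewrite mulrBr mulr1 occupancy_mean -[X in _ <= X - _](pool_mean_cst _ x).
rewrite -mulNr -pool_meanZ -pool_meanD; apply: pool_mean_le => n.
case: leqP => Kn; first by rewrite (eqP Kn) mulr1 subrr.
by rewrite mulr0 addr0 ler_nat leq_subr.
Qed.

Lemma shortfall_ge0 K x : 0 <= shortfall K x.
Proof. exact: pool_mean_ge0. Qed.

Lemma excess_ge0 K x : 0 <= excess K x.
Proof. exact: pool_mean_ge0. Qed.

Lemma shortfall_leK K x : shortfall K x <= K%:R.
Proof.
by apply: le_trans (shortfall_le K x) _; rewrite ler_piMr// gerBl.
Qed.

Context (lambda : R).
Hypothesis lambda_gt0 : 0 < lambda.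

Let K := Num.truncn lambda.
(** [kappa] is the gap from [lambda] to K + 1, and [L] bounds lam / N once it is close to [lambda].
    [A] makes L U^2 / kappa^2 equal to (A / 2) U^2 with U = V - lambda: the drift of Z produces this
    term and that of A U^2 absorbs it. *)
Let kappa : R := K%:R + 1 - lambda.
Let L : R := lambda + 1.
Let A : R := 2 * L / kappa ^+ 2.

Let kappa_gt0 : 0 < kappa.
Proof.
have /andP[_] := truncn_itv (ltW lambda_gt0).
by rewrite /kappa -natr1 subr_gt0.
Qed.

Let A_gt0 : 0 < A.
Proof. by rewrite divr_gt0 ?exprn_gt0// mulr_gt0// addr_gt0. Qed.

Definition lyapunov x : R :=
  excess K x + A * (mean_tasks x - lambda) ^+ 2 + shortfall K x ^+ 2.

Lemma lyapunov_ge0 x : 0 <= lyapunov x.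
Proof.
rewrite !addr_ge0 ?sqr_ge0 ?excess_ge0//.
by apply: mulr_ge0 (ltW A_gt0) _; exact: sqr_ge0.
Qed.

(** For fixed N a bound on [lyapunov] bounds V, and N V dominates every task count. This matters for
    infinite capacity, where there are infinitely many states. *)
Lemma finite_lyapunov_le M : finite_set [set x | lyapunov x <= M].
Proof.
pose m := Num.truncn (N%:R * (lambda + 1 + M / A)).
have xm x : lyapunov x <= M -> forall j, (tasks x j < m.+1)%N.
  move=> xM j; rewrite -(ltr_nat R); apply: le_lt_trans (truncnS_gt _).
  have xV : (tasks x j)%:R <= N%:R * mean_tasks x.
    rewrite /mean_tasks /pool_mean mulrC mulfVK ?gt_eqF//.
    by rewrite (bigD1 j)//= lerDl sumr_ge0.
  apply: le_trans xV _; rewrite ler_pM2l//.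
  have U2 : (mean_tasks x - lambda) ^+ 2 <= M / A.
    rewrite ler_pdivlMr// mulrC; apply: le_trans xM.
    have := excess_ge0 K x; have := sqr_ge0 (shortfall K x).
    rewrite /lyapunov; lra.
  have : 0 <= (mean_tasks x - lambda - 1) ^+ 2 by exact: sqr_ge0.
  have : 0 <= (mean_tasks x - lambda) ^+ 2 by exact: sqr_ge0.
  lra.
pose emb (y : {ffun 'I_N -> 'I_m.+1}) : {ffun 'I_N -> nat} :=
  [ffun j => val (y j)].
have fin : finite_set (emb @` setT) by apply: finite_image; exact: finite_finset.
apply: sub_finite_set (finite_preimage _ fin); last first.
  by move=> x y _ _; exact: val_inj.
move=> x /xm xlt; exists [ffun j => Ordinal (xlt j)] => //.
by apply/ffunP => j; rewrite !ffunE.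
Qed.

Lemma occupancy_dist x i :
  `|q x i - qstar_coord lambda i| <=
  `|mean_tasks x - lambda| + shortfall K x + excess K x.
Proof.
have W0 := shortfall_ge0 K x; have Z0 := excess_ge0 K x.
have U0 := normr_ge0 (mean_tasks x - lambda).
rewrite /qstar_coord -/K; have [iK|Ki] := leqP i K.
  have /andP[_ q1] := occupancy_frac01 x i.
  rewrite distrC ger0_norm ?subr_ge0//.
  suff : 1 - q x i <= shortfall K x by lra.
  rewrite lerBlDr occupancy_mean -[leLHS](pool_mean_cst 1 x) -pool_meanD.
  apply: pool_mean_le => n; case: leqP => ni; first by rewrite lerDr.
  by rewrite addr0 (ler_nat _ 1) subn_gt0 (leq_trans ni).
case: eqP => [->|/eqP iK].
  have -> : q x K.+1 - (lambda - K%:R) =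
      mean_tasks x - lambda + shortfall K x - excess K x.
    (* This identity V + W = K + q_(K+1) + Z already holds pool by pool. *)
    suff : mean_tasks x + shortfall K x = K%:R + q x K.+1 + excess K x by lra.
    rewrite occupancy_mean -(pool_mean_cst K%:R x) -!pool_meanD.
    congr (_ / _); apply: eq_bigr => j _; rewrite -!natrD; congr _%:R.
    by case: leqP => xK; lia.
  apply: le_trans (ler_normB _ _) _; rewrite [X in _ + X]ger0_norm//.
  by rewrite lerD2r (le_trans (ler_normD _ _))// [X in _ + X]ger0_norm.
have K1i : (K.+1 < i)%N by rewrite ltn_neqAle eq_sym iK.
rewrite subr0 ger0_norm ?divr_ge0//.
suff : q x i <= excess K x by lra.
rewrite occupancy_mean; apply: pool_mean_le => n; case: leqP => //= ni.
by rewrite (ler_nat _ 1) subn_gt0 (leq_trans K1i).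
Qed.

(** V - lambda and W enter [lyapunov] squared, so |u| <= e + u^2 / e is applied to both, at the cost
    of the constant 2 e; Z enters linearly. *)
Lemma occupancy_dist_lyapunov x i e : 0 < e ->
  `|q x i - qstar_coord lambda i| <=
  2 * e + (1 + A^-1 / e + e^-1) * lyapunov x.
Proof.
move=> e0; apply: le_trans (occupancy_dist x i) _.
have amgm (u : R) : `|u| <= e + u ^+ 2 / e.
  rewrite -(ler_pM2r e0) mulrDl mulfVK ?gt_eqF// -real_normK ?num_real//.
  by have := sqr_ge0 (`|u| - e); have := sqr_ge0 `|u|; have := sqr_ge0 e; lra.
have := amgm (mean_tasks x - lambda); have := amgm (shortfall K x).
rewrite [`|shortfall _ _|]ger0_norm ?shortfall_ge0//.
have A1 : 0 <= A^-1 by rewrite invr_ge0 ltW.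
have e1 : 0 <= e^-1 by rewrite invr_ge0 ltW.
have Z0 := excess_ge0 K x.
have W2 : 0 <= shortfall K x ^+ 2 by exact: sqr_ge0.
have U2 : 0 <= A * (mean_tasks x - lambda) ^+ 2.
  by apply: mulr_ge0 (ltW A_gt0) _; exact: sqr_ge0.
have -> : (mean_tasks x - lambda) ^+ 2 / e =
    A^-1 / e * (A * (mean_tasks x - lambda) ^+ 2).
  by rewrite [RHS]mulrACA mulVf ?gt_eqF// mul1r mulrC.
rewrite /lyapunov; set U' := A * _ in U2 *; set W' := _ ^+ 2 in W2 *.
have : 0 <= A^-1 / e * (excess K x + W') by rewrite !mulr_ge0// addr_ge0.
have : 0 <= e^-1 * (excess K x + U') by rewrite !mulr_ge0// addr_ge0.
lra.
Qed.

End PoolState.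

(** * Jumps of the JSQ(d) chain and drifts of pool averages *)

Section JSQDrift.
Context (R : realType) (N : nat) (B : option nat).
Context (lam : R) (d : nat) (tau : pool_state N B -> {set 'I_N} -> 'I_N -> R).
Hypotheses (N_gt0 : (0 < N)%N) (lam_ge0 : 0 <= lam) (d_bounds : (1 <= d <= N)%N).
Hypothesis tau_rule : tie_breaking_rule tau.
Implicit Types (x y : pool_state N B) (j k : 'I_N) (h : nat -> R).

Let N0 : 0 < N%:R :> R. Proof. by rewrite ltr0n. Qed.

Local Notation a := (assign_prob d tau).
Local Notation q x i := ((occupancy x i)%:R / N%:R : R).
Local Notation ell := (lam / N%:R).
Local Notation mean_tasks := (@mean_tasks R N B).
Local Notation shortfall := (@shortfall R N B).
Local Notation excess := (@excess R N B).

(** [inl j] is an arrival assigned to pool j, [inr j] a departure from it. *)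
Definition jsq_rate (i : 'I_N + 'I_N) x : R :=
  match i with
  | inl j => if le_cap (tasks x j).+1 B then lam * a x j else 0
  | inr j => (tasks x j)%:R
  end.

(** An arrival at a full pool would leave the state space; [insubd] then returns [x], and the rate
    is 0. *)
Definition jsq_jump (i : 'I_N + 'I_N) x : pool_state N B :=
  insubd x (match i with inl j => add_task x j | inr j => remove_task x j end).

Lemma add_taskP x j : le_cap (tasks x j).+1 B ->
  [forall k, le_cap (add_task x j k) B].
Proof.
move=> xj; apply/forallP => k; rewrite ffunE.
by case: eqP => [->|_]; rewrite ?addn1// addn0 tasks_le_cap.
Qed.

Lemma remove_taskP x j : [forall k, le_cap (remove_task x j k) B].
Proof.
apply/forallP => k; rewrite ffunE.
by apply: le_capW (tasks_le_cap x k); exact: leq_subr.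
Qed.

Lemma jsq_generator_jump x y : jsq_generator lam d tau x y =
  \sum_i jsq_rate i x * ((jsq_jump i x == y)%:R - (x == y)%:R).
Proof.
rewrite big_sumType/= /jsq_generator; congr (_ + _).
  rewrite big_mkcond; apply: eq_bigr => j _; case: ifPn => xj.
    by rewrite -[jsq_jump _ _ == _]val_eqE /= val_insubd add_taskP.
  by rewrite mul0r.
by apply: eq_bigr => j _; rewrite -[jsq_jump _ _ == _]val_eqE /= val_insubd remove_taskP.
Qed.

Lemma tasks_arrival x j k : le_cap (tasks x j).+1 B ->
  tasks (jsq_jump (inl j) x) k = (tasks x k + (k == j))%N.
Proof. by move=> xj; rewrite /tasks val_insubd add_taskP// ffunE. Qed.

Lemma tasks_departure x j k :
  tasks (jsq_jump (inr j) x) k = (tasks x k - (k == j))%N.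
Proof. by rewrite /tasks val_insubd remove_taskP ffunE. Qed.

Lemma pool_mean_arrival h x j : le_cap (tasks x j).+1 B ->
  pool_mean h (jsq_jump (inl j) x) - pool_mean h x =
  (h (tasks x j).+1 - h (tasks x j)) / N%:R.
Proof.
move=> xj; rewrite -mulrBl; congr (_ / _).
rewrite -sumrB (bigD1 j)//= tasks_arrival// eqxx addn1 big1 ?addr0// => k.
by move=> /negPf kj; rewrite tasks_arrival// kj addn0 subrr.
Qed.

Lemma pool_mean_departure h x j :
  pool_mean h (jsq_jump (inr j) x) - pool_mean h x =
  (h (tasks x j).-1 - h (tasks x j)) / N%:R.
Proof.
rewrite -mulrBl; congr (_ / _).
rewrite -sumrB (bigD1 j)//= tasks_departure eqxx subn1 big1 ?addr0// => k.
by move=> /negPf kj; rewrite tasks_departure kj subn0 subrr.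
Qed.

Lemma drift_pool_mean h x : drift jsq_rate jsq_jump (pool_mean h) x =
  lam / N%:R * (\sum_(j | le_cap (tasks x j).+1 B)
    a x j * (h (tasks x j).+1 - h (tasks x j))) +
  pool_mean (fun n => n%:R * (h n.-1 - h n)) x.
Proof.
rewrite /drift big_sumType/=; congr (_ + _).
  rewrite big_distrr/= [RHS]big_mkcond/=; apply: eq_bigr => j _.
  case: ifPn => xj; last by rewrite mul0r.
  by rewrite pool_mean_arrival//; ring.
by rewrite [RHS]big_distrl/=; apply: eq_bigr => j _; rewrite pool_mean_departure mulrA.
Qed.

Lemma assign_prob_ge0 x j : 0 <= a x j.
Proof.
rewrite divr_ge0// sumr_ge0// => A /eqP Ad.
have A0 : A != finset.set0 by rewrite -card_gt0 Ad; case/andP: d_bounds.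
by have [] := tau_rule x A0.
Qed.

Let Cd0 : 0 < 'C(N, d)%:R :> R.
Proof. by rewrite ltr0n bin_gt0; case/andP: d_bounds. Qed.

Lemma sum_assign_prob x : \sum_j a x j = 1.
Proof.
rewrite -big_distrl/= exchange_big/=.
rewrite (eq_bigr (fun=> 1)) => [|A /eqP Ad]; last first.
  have A0 : A != finset.set0 by rewrite -card_gt0 Ad; case/andP: d_bounds.
  by have [] := tau_rule x A0.
by rewrite sumr_const -[#|_|]cardsE card_draws card_ord divff ?gt_eqF.
Qed.

(** The s_i of the overview; tasks are counted before the arrival. *)
Definition assign_tail x (i : nat) : R := \sum_(j | (i <= tasks x j)%N) a x j.

Lemma assign_tail_ge0 x i : 0 <= assign_tail x i.
Proof. by rewrite sumr_ge0// => j _; exact: assign_prob_ge0. Qed.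

Lemma assign_tailC x i :
  \sum_(j | (tasks x j < i)%N) a x j = 1 - assign_tail x i.
Proof.
rewrite -(sum_assign_prob x) [in RHS](bigID (fun j => (i <= tasks x j)%N))/=.
rewrite addrAC subrr add0r; apply: eq_bigl => j; by rewrite ltnNge.
Qed.

Lemma assign_tail_le1 x i : assign_tail x i <= 1.
Proof.
rewrite -subr_ge0 -assign_tailC sumr_ge0// => j _; exact: assign_prob_ge0.
Qed.

(* The assigned pool minimizes over the sample, so it holds i or more tasks only
   if every sampled pool does. *)
Lemma assign_tail_le x i : assign_tail x i <= q x i ^+ d.
Proof.
pose L : {set 'I_N} := [set j | (i <= tasks x j)%N]%SET.
have occL : occupancy x i = #|L| by apply: eq_card => j; rewrite !inE.
(* The middle term is the proportion of samples contained in [L]. *)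
apply: (@le_trans _ _ ('C(occupancy x i, d)%:R / 'C(N, d)%:R)).
  rewrite /assign_tail -big_distrl/= ler_pM2r ?invr_gt0// exchange_big/=.
  rewrite occL -cards_draws -sum1_card natr_sum.
  rewrite [leRHS]big_mkcond/= [leLHS]big_mkcond/=; apply: ler_sum => A _.
  rewrite inE andbC; case: eqP => //= Ad.
  have A0 : A != finset.set0 by rewrite -card_gt0 Ad; case/andP: d_bounds.
  have [t0 t1 tmin] := tau_rule x A0.
  case: ifPn => AL.
    rewrite -t1 [leRHS](bigID (fun j => (i <= tasks x j)%N))/= lerDl.
    by rewrite sumr_ge0.
  rewrite big1// => j ij; apply/eqP/contraT => /tmin[jA jmin].
  case/negP: AL; apply/fintype.subsetP => k kA; rewrite inE.
  exact: leq_trans (jmin k kA).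
rewrite expr_div_n ler_pdivrMr// mulrAC ler_pdivlMr ?exprn_gt0//.
rewrite -!natrX -!natrM ler_nat [leqRHS]mulnC; apply: bin_mul_expn_le.
by rewrite -[leqRHS]card_ord max_card.
Qed.

(** Either q_i is close to 1 or q_i^d is small: d q^d (1 - q) never exceeds 1. *)
Lemma assign_tail_onem x i : (1 - q x i) * assign_tail x i <= d%:R^-1.
Proof.
have d0 : 0 < d%:R :> R by rewrite ltr0n; case/andP: d_bounds.
have q01 := occupancy_frac01 R N_gt0 x i.
rewrite -[leRHS]mul1r ler_pdivlMr//; apply: le_trans (exprn_onem_le d q01).
have -> : d%:R * q x i ^+ d * (1 - q x i) = (1 - q x i) * q x i ^+ d * d%:R.
  ring.
apply: ler_wpM2r => //.
apply: ler_wpM2l; first by rewrite subr_ge0; case/andP: q01.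
exact: assign_tail_le.
Qed.

(** A jump moves a pool mean by at most 1 / N, so each rate is weighted by at most 1 / N^2; the
    arrival rates add up to at most lam. *)
Lemma jump_variance_le h x : (forall n, (h n.+1 - h n) ^+ 2 <= 1) ->
  \sum_i jsq_rate i x * (pool_mean h (jsq_jump i x) - pool_mean h x) ^+ 2 <=
  (lam / N%:R + pool_mean (fun n => n%:R * (h n.-1 - h n) ^+ 2) x) / N%:R.
Proof.
move=> h1; rewrite big_sumType/= mulrDl lerD//.
  have -> : lam / N%:R / N%:R = \sum_j lam * a x j * N%:R^-1 ^+ 2.
    rewrite -big_distrl -big_distrr/= sum_assign_prob mulr1; ring.
  apply: ler_sum => j _; case: ifPn => xj; last first.
    rewrite mul0r mulr_ge0 ?sqr_ge0// mulr_ge0//; exact: assign_prob_ge0.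
  rewrite pool_mean_arrival//.
  apply: ler_wpM2l; first by rewrite mulr_ge0// assign_prob_ge0.
  by rewrite exprMn ler_piMl// exprn_ge0// invr_ge0.
rewrite [leRHS](_ : _ = \sum_j (tasks x j)%:R *
    (h (tasks x j).-1 - h (tasks x j)) ^+ 2 / N%:R / N%:R); last first.
  by rewrite /pool_mean !big_distrl.
apply: ler_sum => j _; rewrite pool_mean_departure; lra.
Qed.

Local Notation drift := (drift jsq_rate jsq_jump).

Definition blocked x : R := \sum_(j | ~~ le_cap (tasks x j).+1 B) a x j.

Lemma blocked_ge0 x : 0 <= blocked x.
Proof. by rewrite sumr_ge0// => j _; exact: assign_prob_ge0. Qed.

Lemma drift_mean_tasks x :
  drift mean_tasks x = ell * (1 - blocked x) - mean_tasks x.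
Proof.
rewrite drift_pool_mean; congr (_ * _ + _).
  rewrite -[X in X - _](sum_assign_prob x) [in RHS](bigID (fun j => le_cap (tasks x j).+1 B)).
  rewrite /= addrK; apply: eq_bigr => j _; rewrite -natr1; ring.
rewrite -mulN1r -pool_meanZ; congr (_ / _); apply: eq_bigr => j _ /=.
by case: (tasks x j) => [|n] /=; rewrite ?mul0r ?mulr0// -natr1; ring.
Qed.

(** A departure from a pool with n tasks raises (K - n)^+ only if n <= K, and then its rate is n = K
    - (K - n)^+. An arrival lowers it exactly at pools below K, which are never full because K <=
    B. *)
Lemma drift_shortfall K x : le_cap K B ->
  drift (shortfall K) x <=
  K%:R - shortfall K x - ell * (1 - assign_tail x K).
Proof.
move=> capK; rewrite drift_pool_mean [leLHS]addrC -[- (ell * _)]mulrN; apply: lerD.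
  rewrite -[X in _ <= X - _](pool_mean_cst N_gt0 _ x) -mulN1r -pool_meanZ.
  rewrite -pool_meanD; apply: pool_mean_le => -[|n] /=.
    by rewrite mul0r subn0; lra.
  have [nK|Kn] := ltnP n K.
    have -> : (K - n)%:R = (K - n.+1)%:R + 1 :> R by rewrite natr1 subnSK.
    have : K%:R = (K - n.+1)%:R + n.+1%:R :> R by rewrite -natrD subnK.
    lra.
  by rewrite (eqP Kn) (eqP (leqW Kn)) subrr mulr0 mulr0 addr0.
rewrite ler_wpM2l ?divr_ge0// -assign_tailC -sumrN.
rewrite [leLHS]big_mkcond [leRHS]big_mkcond/=.
apply: ler_sum => j _; have [xK|Kx] := ltnP (tasks x j) K.
  rewrite (le_capW xK capK) -(subnSK xK) -natr1; lra.
by case: ifPn => //; rewrite (eqP Kx) (eqP (leqW Kx)) subrr mulr0.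
Qed.

(** Only arrivals at pools with at least K + 1 tasks raise the excess. A pool with positive excess
    loses one unit of it at rate n, which is at least that excess. *)
Lemma drift_excess K x :
  drift (excess K) x <= ell * assign_tail x K.+1 - excess K x.
Proof.
rewrite drift_pool_mean lerD//.
  rewrite ler_wpM2l ?divr_ge0// [leLHS]big_mkcond [leRHS]big_mkcond/=; apply: ler_sum => j _.
  have [Kx|xK] := ltnP K (tasks x j).
    by case: ifPn => _; rewrite ?assign_prob_ge0// subSn// -natr1; lra.
  by case: ifPn => //; rewrite (eqP (leqW xK)) subSS (eqP xK) subrr mulr0.
rewrite -mulN1r -pool_meanZ; apply: pool_mean_le => -[|n] /=.
  by rewrite mul0r sub0n mulr0.
have [Kn|nK] := ltnP K n.
  rewrite subSS -(subnSK Kn) -!natr1.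
  have : 0 <= n%:R :> R by []. 
  have : (n - K.+1)%:R <= n%:R :> R by rewrite ler_nat leq_subr.
  lra.
by rewrite subSS (eqP (leqW nK)) (eqP nK) subrr !mulr0.
Qed.

Lemma shortfall_tail K x : shortfall K x * assign_tail x K <= K%:R / d%:R.
Proof.
apply: (@le_trans _ _ (K%:R * ((1 - q x K) * assign_tail x K))).
  by rewrite mulrA ler_wpM2r ?assign_tail_ge0// shortfall_le.
by rewrite ler_wpM2l// assign_tail_onem.
Qed.

(** Since i q_i <= V, the factor i - V is at most i (1 - q_i). *)
Lemma mean_tasks_tail i x :
  (i%:R - mean_tasks x) * assign_tail x i <= i%:R / d%:R.
Proof.
apply: (@le_trans _ _ (i%:R * ((1 - q x i) * assign_tail x i))).
  rewrite mulrA ler_wpM2r ?assign_tail_ge0//.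
  have := mean_tasks_ge R x i; lra.
by rewrite ler_wpM2l// assign_tail_onem.
Qed.

(** * Drift of the Lyapunov function *)

Context (lambda : R).
Hypothesis lambda_gt0 : 0 < lambda.
Hypothesis lambda_le_B : forall b, B = Some b -> lambda <= b%:R.

(** The value 0 fits infinite capacity, where no task is blocked. *)
Let beta : R := if B is Some b then b%:R else 0.
Let K := Num.truncn lambda.
Let kappa : R := K%:R + 1 - lambda.
Let L : R := lambda + 1.
Let A : R := 2 * L / kappa ^+ 2.

Let capK : le_cap K B.
Proof.
case BE : B => [b|]//=; rewrite -(ler_nat R).
have /andP[Kl _] := truncn_itv (ltW lambda_gt0).
exact: le_trans (lambda_le_B BE).
Qed.

(** For finite B, [blocked] is s_B, and lambda <= B gives lambda - V <= B - V. A one-sided bound is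
    enough: blocking harms the drift of (V - lambda)^2 only while V < lambda. *)
Lemma mean_tasks_blocked x : (lambda - mean_tasks x) * blocked x <= beta / d%:R.
Proof.
suff bound C : B = C -> (lambda - mean_tasks x) * blocked x <=
    (if C is Some b then b%:R else 0) / d%:R by exact: bound.
case: C => [b|] BE; last first.
  have cap m : le_cap m B by rewrite BE.
  rewrite /blocked big_pred0 ?mulr0 ?mul0r// => j.
  by rewrite cap.
have cap m : le_cap m B = (m <= b)%N by rewrite BE.
have -> : blocked x = assign_tail x b.
  by apply: eq_bigl => j; rewrite cap -leqNgt.
apply: le_trans (mean_tasks_tail b x); rewrite ler_wpM2r ?assign_tail_ge0//.
by rewrite lerD2r lambda_le_B.
Qed.

Let kappa_gt0 : 0 < kappa.
Proof.
have /andP[_] := truncn_itv (ltW lambda_gt0).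
by rewrite /kappa -natr1 subr_gt0.
Qed.

(** With U = V - lambda and t = s_(K+1), the tail estimate reads (kappa - U) t <= (K + 1) / d. The
    term U t is split so that half of kappa t is absorbed on the left. *)
Lemma assign_tailS_le x : assign_tail x K.+1 <=
  2 * (K%:R + 1) / kappa / d%:R + (mean_tasks x - lambda) ^+ 2 / kappa ^+ 2.
Proof.
have := mean_tasks_tail K.+1 x; rewrite -natr1.
have := assign_tail_ge0 x K.+1; have := assign_tail_le1 x K.+1.
set t := assign_tail _ _ => t1 t0 Vt.
set U := mean_tasks x - lambda.
have UE : K%:R + 1 - mean_tasks x = kappa - U by rewrite /kappa /U; ring.
rewrite {}UE in Vt.
have kt : kappa * t <= (K%:R + 1) / d%:R + U * t by move: Vt; lra.
(* AM-GM : 2 U t <= kappa t^2 + U^2 / kappa *)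
have Ut : 2 * U * t <= kappa * t + U ^+ 2 / kappa.
  apply: (@le_trans _ _ (kappa * t ^+ 2 + U ^+ 2 / kappa)); last first.
    by rewrite lerD2r ler_wpM2l ?(ltW kappa_gt0)// expr2 ler_piMl.
  rewrite -subr_ge0.
  have -> : kappa * t ^+ 2 + U ^+ 2 / kappa - 2 * U * t =
      (kappa * t - U) ^+ 2 / kappa by field; rewrite gt_eqF.
  by rewrite divr_ge0 ?sqr_ge0// ltW.
have k2 : kappa * t <= 2 * ((K%:R + 1) / d%:R) + U ^+ 2 / kappa by lra.
rewrite -(ler_pM2l kappa_gt0); apply: le_trans k2 _; rewrite le_eqVlt.
apply/orP; left; apply/eqP; field.
by rewrite !gt_eqF// ltr0n; case/andP: d_bounds.
Qed.

(** The sum of all coefficients of the three errors in [A] times [S1], in [S2] and in [S3] of the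
    next proof. *)
Definition drift_const : R :=
  A * (1 + 2 * L * beta + 2 * L) + 2 * K%:R + 2 * L * K%:R + (L + K%:R) +
  2 * L * (K%:R + 1) / kappa.

Lemma drift_const_ge0 : 0 <= drift_const.
Proof.
have L1 : 0 <= L by rewrite addr_ge0// ltW.
have L2 : 0 <= 2 * L by rewrite mulr_ge0.
have A0 : 0 <= A by rewrite divr_ge0// sqr_ge0.
have beta0 : 0 <= beta by rewrite /beta; case: (B).
have K0 : 0 <= K%:R :> R by [].
have T1 : 0 <= A * (1 + 2 * L * beta + 2 * L).
  by apply: mulr_ge0 => //; rewrite !addr_ge0//; exact: mulr_ge0.
have T2 : 0 <= 2 * L * K%:R by exact: mulr_ge0.
have T3 : 0 <= 2 * L * (K%:R + 1) / kappa.
  by apply: divr_ge0 (ltW kappa_gt0); apply: mulr_ge0 => //; exact: addr_ge0.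
rewrite /drift_const; lra.
Qed.

Lemma drift_lyapunov x : `|ell - lambda| <= 4^-1 -> N%:R^-1 <= 4^-1 :> R ->
  drift (lyapunov lambda) x <=
    drift_const * (`|ell - lambda| + d%:R^-1 + N%:R^-1) - lyapunov lambda x.
Proof.
set l := ell; set e := `|_| => e4 n4.
have driftE : drift (lyapunov lambda) x = drift (excess K) x +
    A * (2 * (mean_tasks x - lambda) * drift mean_tasks x +
         \sum_i jsq_rate i x * (mean_tasks (jsq_jump i x) - mean_tasks x) ^+ 2) +
    (2 * shortfall K x * drift (shortfall K) x +
     \sum_i jsq_rate i x * (shortfall K (jsq_jump i x) - shortfall K x) ^+ 2).
  rewrite -(drift_sqr _ _ mean_tasks lambda) -driftZ.
  have := drift_sqr jsq_rate jsq_jump (shortfall K) 0 x.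
  rewrite subr0 => <-; rewrite -!driftD; apply: eq_bigr => i _.
  by rewrite !subr0.
have varV : \sum_i jsq_rate i x *
    (mean_tasks (jsq_jump i x) - mean_tasks x) ^+ 2 <=
    (ell + mean_tasks x) / N%:R.
  apply: le_trans (jump_variance_le _ _) _ => [n|].
    by rewrite -natr1 addrAC subrr add0r expr1n.
  rewrite ler_pM2r ?invr_gt0// lerD2l; apply: pool_mean_le => -[|n] /=.
    by rewrite mul0r.
  by rewrite -[n.+1%:R]natr1 opprD addrA subrr add0r sqrrN expr1n mulr1.
have varW : \sum_i jsq_rate i x *
    (shortfall K (jsq_jump i x) - shortfall K x) ^+ 2 <= (ell + K%:R) / N%:R.
  have sq n : ((K - n.+1)%:R - (K - n)%:R : R) ^+ 2 = (n < K)%:R.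
    case: ltnP => nK; last by rewrite (eqP nK) (eqP (leqW nK)) subrr expr0n.
    by rewrite -(subnSK nK) -natr1 opprD addrA subrr add0r sqrrN expr1n.
  apply: le_trans (jump_variance_le _ _) _ => [n|].
    by rewrite sq; case: ltnP.
  rewrite ler_pM2r ?invr_gt0// lerD2l -[leRHS](pool_mean_cst N_gt0 _ x).
  apply: pool_mean_le => -[|n] /=; first by rewrite mul0r.
  rewrite -sqrrN opprB sq; case: ltnP => nK; last by rewrite mulr0.
  by rewrite mulr1 ler_nat.
have := assign_tailS_le x.
have := drift_excess K x; have := drift_shortfall x capK.
have := mean_tasks_blocked x; have := shortfall_tail K x.
have := shortfall_leK R N_gt0 K x; have := shortfall_ge0 R K x; have := excess_ge0 R K x.
have := blocked_ge0 x.
rewrite driftE drift_mean_tasks /lyapunov -/K -/kappa -/L -/A.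
move: varV varW; rewrite -/l.
set V2 := \sum_i _; set W2 := \sum_i _.
set V := mean_tasks x; set W := shortfall K x; set Z := excess K x.
set b := blocked x; set tK := assign_tail x K; set t1 := assign_tail x K.+1.
set dW := drift (shortfall K) x; set dZ := drift (excess K) x.
move=> V2le W2le b0 Z0 W0 WK WtK Vb dWle dZle t1le.
have /andP[Kl _] := truncn_itv (ltW lambda_gt0).
rewrite -/K in Kl.
have l0 : 0 <= l by rewrite divr_ge0.
have L0 : 0 < L by rewrite addr_gt0.
have A0 : 0 <= A by rewrite divr_ge0 ?sqr_ge0// mulr_ge0// ltW.
have D0 : 0 <= d%:R^-1 :> R by rewrite invr_ge0.
have n0 : 0 <= N%:R^-1 :> R by rewrite invr_ge0.
have K0 : 0 <= K%:R :> R by [].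
have beta0 : 0 <= beta by rewrite /beta; case: (B).
have e0 : 0 <= e by exact: normr_ge0.
have [el el'] : l - lambda <= e /\ lambda - l <= e.
  by split; [exact: ler_norm|rewrite /e distrC ler_norm].
have lL : l <= L by rewrite /L; lra.
set U := V - lambda in t1le *.
have VE : V = lambda + U by rewrite /U; ring.
have U20 : 0 <= U ^+ 2 by exact: sqr_ge0.
set n := N%:R^-1 in V2le W2le n4 n0 *; set D := d%:R^-1 in D0 WtK Vb t1le *.
(* [c1] and [c2] add up to 2 U (l - lambda) <= e (1 + U^2). As e and n are at most 1/4, the
   coefficient of U^2 is -2 + 1/4 + 1/4 = -3/2. *)
have S1 : 2 * U * (l * (1 - b) - V) + V2 <=
    - (3 / 2) * U ^+ 2 + e + 2 * L * beta * D + 2 * L * n.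
  have c1 : 0 <= (1 + U) ^+ 2 * (e - (l - lambda)).
    by rewrite mulr_ge0 ?sqr_ge0// subr_ge0.
  have c2 : 0 <= (1 - U) ^+ 2 * (e + (l - lambda)).
    by rewrite mulr_ge0 ?sqr_ge0//; lra.
  have c3 : e * U ^+ 2 <= 4^-1 * U ^+ 2 by rewrite ler_wpM2r.
  have c4 : l * (- U * b) <= L * (beta * D).
    apply: (@le_trans _ _ (l * (beta * D))); last first.
      by rewrite ler_wpM2r// mulr_ge0.
    by rewrite ler_wpM2l// opprB.
  have c5 : (l + V) * n <= (2 * L + U ^+ 2) * n.
    rewrite ler_wpM2r//; have : 0 <= (1 - U) ^+ 2 by exact: sqr_ge0.
    rewrite VE /L; lra.
  have c6 : n * U ^+ 2 <= 4^-1 * U ^+ 2 by rewrite ler_wpM2r.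
  rewrite VE; rewrite VE in V2le c5; lra.
(* K <= lambda makes K - l at most e. The product W s_K is small although s_K need not be, which is
   why W enters squared. *)
have S2 : 2 * W * dW + W2 <=
    - 2 * W ^+ 2 + 2 * K%:R * e + 2 * L * K%:R * D + (L + K%:R) * n.
  have c1 : W * dW <= W * (e - W + l * tK) by apply: (ler_wpM2l W0); lra.
  have c2 : W * e <= K%:R * e by rewrite ler_wpM2r.
  have c3 : l * (W * tK) <= L * (K%:R * D).
    apply: (@le_trans _ _ (l * (K%:R * D))); first by rewrite ler_wpM2l.
    by rewrite ler_wpM2r// mulr_ge0.
  have c4 : (l + K%:R) * n <= (L + K%:R) * n by rewrite ler_wpM2r// lerD2r.
  lra.
(* By the choice of [A] the quadratic term is (A / 2) U^2; against -3/2 A U^2 from [S1] it leaves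
   the required -A U^2. *)
have S3 : dZ <= 2 * L * (K%:R + 1) / kappa * D + A / 2 * U ^+ 2 - Z.
  apply: le_trans dZle _; rewrite lerD2r.
  apply: (@le_trans _ _ (L * t1)).
    by rewrite ler_wpM2r// /t1 assign_tail_ge0.
  apply: le_trans (ler_wpM2l (ltW L0) t1le) _; rewrite le_eqVlt; apply/orP; left.
  by apply/eqP; rewrite /A /D; field; rewrite !gt_eqF// ltr0n; case/andP: d_bounds.
have S1A := ler_wpM2l A0 S1.
have AU : 0 <= A * U ^+ 2 by rewrite mulr_ge0.
have L1 := ltW L0.
have L2 : 0 <= 2 * L by rewrite mulr_ge0.
have ALb : 0 <= A * (2 * L * beta) by apply: mulr_ge0 => //; exact: mulr_ge0.
have AL : 0 <= A * (2 * L) by exact: mulr_ge0.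
have LK : 0 <= 2 * L * K%:R by exact: mulr_ge0.
have k1 : 0 <= 2 * L * (K%:R + 1) / kappa.
  by apply: divr_ge0; [apply: mulr_ge0 => //; exact: addr_ge0|exact: ltW].
have W20 : 0 <= W ^+ 2 by exact: sqr_ge0.
rewrite /drift_const.
set c4 := 2 * L * _ / _ in k1 S3 *.
(* Each error coefficient is completed by its products with the other two errors, to reach
   [drift_const] times their sum. *)
have pDn c : 0 <= c -> 0 <= c * (D + n) by move=> ?; rewrite mulr_ge0// addr_ge0.
have pen c : 0 <= c -> 0 <= c * (e + n) by move=> ?; rewrite mulr_ge0// addr_ge0.
have peD c : 0 <= c -> 0 <= c * (e + D) by move=> ?; rewrite mulr_ge0// addr_ge0.
have := pDn _ A0; have := pen _ ALb; have := peD _ AL.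
have := pDn _ K0; have := pen _ LK; have := pen _ k1.
have := peD _ K0; have := peD _ L1.
lra.
Qed.

End JSQDrift.

(** * Integrals against a nearly concentrated probability *)

(** The integrand |phi - c| is at most [e] on [U] and at most M + |c| elsewhere. *)
Lemma Rintegral_dist_le (d : measure_display) (T : measurableType d)
    (R : realType) (mu : probability T R) (phi : T -> R) (U : set T)
    (M c e : R) :
  measurable_fun [set: T] phi -> (forall q, `|phi q| <= M) -> measurable U ->
  0 <= e -> (forall q, U q -> `|phi q - c| <= e) ->
  `|(\int[mu]_q phi q) - c| <= e + (M + `|c|) * fine (mu (~` U)).
Proof.
move=> mphi phiM mU e0 phiU.
have fin : (mu [set: T] < +oo)%E by rewrite probability_setT ltry.
have bint (f : T -> R) C : measurable_fun [set: T] f ->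
    (forall q, `|f q| <= C) -> mu.-integrable [set: T] (EFin \o f).
  move=> mf fC; apply: measurable_bounded_integrable => //.
  by exists C; split; [exact: num_real|move=> x Cx q _; exact: le_trans (ltW Cx)].
have mucst r : \int[mu]_q r = r.
  transitivity (r * fine (mu [set: T])); first exact: Rintegral_cst.
  by rewrite probability_setT mulr1.
have icst r : mu.-integrable [set: T] (EFin \o fun=> r).
  by apply: (bint _ `|r|).
have iphi := bint _ _ mphi phiM.
rewrite -[X in _ - X](mucst c) -RintegralB//.
have mphic : measurable_fun [set: T] (fun q => phi q - c).
  by apply: measurable_funB.
have phic q : `|phi q - c| <= M + `|c|.
  by apply: le_trans (ler_normB _ _) _; rewrite lerD2r.
have mUc : measurable (~` U) by exact: measurableC.
have iind : mu.-integrable [set: T] (EFin \o \1_(~` U)).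
  apply: (bint _ 1); first exact: measurable_indic.
  by move=> q; rewrite indicE; case: (_ \in _); rewrite ?normr1 ?normr0.
apply: le_trans (le_normr_Rintegral _ _) _ => //.
  exact: bint phic.
apply: (@le_trans _ _ (\int[mu]_q (e + (M + `|c|) * \1_(~` U) q))).
  apply: le_Rintegral => //.
  - apply: (bint _ (M + `|c|)); first exact: measurableT_comp.
    by move=> q; rewrite normr_id.
  - apply: (bint _ (e + (M + `|c|))).
      apply: (@measurable_funD _ _ _ _ (cst e)); first exact: measurable_cst.
      apply: (@measurable_funM _ _ _ _ (cst (M + `|c|))).
        exact: measurable_cst.
      exact: measurable_indic.
    move=> q; rewrite ger0_norm; last first.
      by rewrite addr_ge0// mulr_ge0// (le_trans (normr_ge0 _) (phic q)).
    by rewrite lerD2l ler_piMr ?(le_trans (normr_ge0 _) (phic q))//.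
  - move=> q _; rewrite indicE; have [Uq|nUq] := pselect (U q).
      rewrite memNset ?mulr0 ?addr0; [exact: phiU|by move=> /(_ Uq)].
    by rewrite mem_set// mulr1 (le_trans (phic q))// lerDr.
have iZind : mu.-integrable [set: T]
    (EFin \o (fun q => (M + `|c|) * \1_(~` U) q)).
  exact: (integrableZl _ (M + `|c|) iind).
rewrite (RintegralD _ (icst e) iZind)// RintegralZl// mucst.
have -> // : \int[mu]_q \1_(~` U) q = fine (mu (~` U)).
by rewrite /Rintegral integral_indic// setIT.
Qed.

(** * Weak convergence *)

Lemma measurable_borel (T : ptopologicalType) (U : set T) :
  open U -> measurable (U : set (borel T)).
Proof. exact: sub_sigma_algebra. Qed.

Lemma continuous_borel_measurable (R : realType) (T : ptopologicalType)
    (phi : T -> R) :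
  continuous phi -> measurable_fun [set: borel T] (phi : borel T -> R).
Proof.
move=> /continuousP cphi; apply: (measurability _ (RGenOpens.measurableE R)).
move=> _ [_ [x [y ->] <-]]; rewrite setTI; apply: measurable_borel.
by apply: cphi; exact: interval_open.
Qed.

(** * Topology of the occupancy space *)

Section OccupancyTopology.
Context (R : realType) (B : option nat).
Local Notation S := (occ_space R B).

Lemma occ_coord_continuous (i : level B) : continuous (fun q : S => val q i).
Proof.
move=> q; apply: (@continuous_comp S {ptws level B -> R} R val (fun p => p i)).
  exact: initial_continuous.
exact: (@proj_continuous _ (fun=> R) i).
Qed.

(** The coordinates are continuous and separate points, so singletons are closed. *)
Lemma measurable_occ_set1 (q : S) : measurable ([set q] : set (borel S)).
Proof.
suff oq : open (~` [set q]).
  have := measurableC (measurable_borel oq); by rewrite setCK.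
have -> : ~` [set q] =
    \bigcup_i ((fun p : S => val p i) @^-1` ~` [set val q i]).
  apply/seteqP; split=> p /=; last first.
    by move=> [i _ /= pqi] pq; apply: pqi; rewrite pq.
  move=> pq; apply: contrapT => npq; apply: pq; apply: val_inj.
  apply/funext => i; apply: contrapT => pqi; apply: npq; by exists i.
apply: bigcup_open => i _; apply: open_comp => [p _|].
  exact: occ_coord_continuous.
exact/closed_openC/accessible_closed_set1/hausdorff_accessible/Rhausdorff.
Qed.

Lemma occ_cvg (u : nat -> S) (q : S) :
  (forall i, val (u n) i @[n --> \oo] --> val q i) -> u n @[n --> \oo] --> q.
Proof.
move=> uq.
have ptws_uq : {ptws, (fun n => val (u n)) @ \oo --> val q}.
  apply/cvg_sup => i A [_ [[V oV <-] Vq VA]].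
  have nV : nbhs (val q i) V by exact: open_nbhs_nbhs.
  have Vu : \forall n \near \oo, V (val (u n) i) := uq i V nV.
  suff : \forall n \near \oo, A (val (u n)) by [].
  by apply: filterS Vu => n Vn; exact: VA.
move=> A [_ [[C oC <-] Cq CA]].
have nC : nbhs (val q : {ptws level B -> R}) C by exact: open_nbhs_nbhs.
have Cu : \forall n \near \oo, C (val (u n)) := ptws_uq C nC.
suff : \forall n \near \oo, A (u n) by [].
by apply: filterS Cu => n Cn; exact: CA.
Qed.

(** One c must serve all N. Otherwise states of varying N outside [U], with [lyapunov] below 1 / (n
    + 1), would converge coordinatewise to the fixed point, because the bound on occupancy distances
    does not depend on N. *)
Lemma lyapunov_small_fluid_near (lambda : R) (lambda_gt0 : 0 < lambda)
    (U : set S) :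
  nbhs (qstar B (ltW lambda_gt0)) U ->
  exists2 c, 0 < c & forall N, (0 < N)%N -> forall x : pool_state N B,
    lyapunov lambda x < c -> U (fluid_state R x).
Proof.
move=> Uq; apply: contrapT => noc.
pose bad n q := ~ U q /\ exists N, (0 < N)%N /\ exists x : pool_state N B,
  q = fluid_state R x /\ lyapunov lambda x < n.+1%:R^-1.
have /choice[u uP] : forall n, exists q, bad n q.
  move=> n; apply: contrapT => nobad; apply: noc; exists n.+1%:R^-1 => //.
  move=> N N0 x xn; apply: contrapT => nU; apply: nobad.
  exists (fluid_state R x); split=> //; exists N; split=> //.
  by exists x.
suff /(_ _ Uq)[n _ /(_ n (leqnn n))] :
    u n @[n --> \oo] --> qstar B (ltW lambda_gt0) by have [] := uP n.
apply: occ_cvg => i; apply/cvgrPdist_le => e e0.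
(* e / 4 makes the constant term of the distance bound e / 2; [a] is the inverse of the weight [A]
   in [lyapunov]. *)
have e4 : 0 < e / 4 by rewrite divr_gt0.
pose a : R := (2 * (lambda + 1) / ((Num.truncn lambda)%:R + 1 - lambda) ^+ 2)^-1.
pose C := 1 + a / (e / 4) + (e / 4)^-1.
have C0 : 0 < C.
  have a0 : 0 <= a.
    by rewrite invr_ge0 divr_ge0 ?sqr_ge0// mulr_ge0// addr_ge0// ltW.
  by rewrite ltr_wpDr ?invr_ge0 ?(ltW e4)// ltr_wpDr// divr_ge0// ltW.
have e2C : 0 < e / 2 / C by rewrite !divr_gt0.
have := near_infty_natSinv_lt (PosNum e2C); apply: filterS => n /= nC.
have Cn : C * n.+1%:R^-1 <= e / 2.
  by rewrite mulrC -ler_pdivlMr// ltW.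
have [_ [N [N0 [x [-> xn]]]]] := uP n.
rewrite distrC; apply: le_trans (occupancy_dist_lyapunov N0 lambda_gt0 x _ e4) _.
have : C * lyapunov lambda x <= C * n.+1%:R^-1.
  by apply: ler_wpM2l (ltW C0) _ _ _; exact: ltW.
rewrite -/a -/C => /le_trans/(_ Cn); set t := C * _; lra.
Qed.

End OccupancyTopology.

(** * Stationary mass away from the fixed point, and the limit *)

Lemma near_natV_le (R : realType) (delta : R) : 0 < delta ->
  \forall n \near \oo, n%:R^-1 <= delta.
Proof.
move=> delta0; have := nbhs_infty_ge (Num.truncn delta^-1).+1.
apply: filterS => n kn.
have dn : delta^-1 < n%:R.
  by apply: lt_le_trans (truncnS_gt _) _; rewrite ler_nat.
rewrite -[leRHS]invrK lef_pV2 ?posrE ?invr_gt0//; first exact: ltW.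
by apply: lt_trans dn; rewrite invr_gt0.
Qed.

(** The function [lyapunov] / c is at least 1 on states mapped outside [U], as the Foster bound
    requires. Intersecting with the range of [fluid_state], which has full mass, gives a countable
    set whose mass is determined by its points. *)
Lemma stationary_mass_le (R : realType) (B : option nat) (lambda : R)
    (N : nat) (lam : R) (d : nat)
    (tau : pool_state N B -> {set 'I_N} -> 'I_N -> R)
    (dO : measure_display) (Omega : measurableType dO)
    (Pr : probability Omega R) (X : R -> Omega -> pool_state N B)
    (pi : probability (borel (occ_space R B)) R)
    (U : set (borel (occ_space R B))) (c : R) :
  (0 < N)%N -> 0 <= lam -> (1 <= d <= N)%N -> tie_breaking_rule tau ->
  0 < lambda -> (forall b, B = Some b -> lambda <= b%:R) ->
  `|lam / N%:R - lambda| <= 4^-1 -> N%:R^-1 <= 4^-1 :> R ->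
  jsq_process lam d tau Pr X -> stationary_occupancy_law Pr X pi ->
  measurable U -> 0 < c ->
  (forall x : pool_state N B, lyapunov lambda x < c -> U (fluid_state R x)) ->
  fine (pi (~` U)) <= c^-1 *
    (drift_const B lambda * (`|lam / N%:R - lambda| + d%:R^-1 + N%:R^-1)).
Proof.
move=> N0 lam0 dN rule l0 lB l4 N4 Xjsq [pi1 pilim] mU c0 lyapU.
have c1 : 0 <= c^-1 by rewrite invr_ge0 ltW.
set eps := drift_const _ _ * _.
have mrange : measurable (range (@fluid_state R N B) : set (borel (occ_space R B))).
  rewrite (_ : range _ = \bigcup_(x in [set: pool_state N B]) [set fluid_state R x]).
    by apply: measurable_bigcup_count => x; exact: measurable_occ_set1.
  apply/seteqP; split=> q; first by move=> [x _ <-]; exists x.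
  by move=> [x _ ->]; exists x.
have mUc : measurable (~` U) by exact: measurableC.
have mUr : measurable (~` U `&` range (@fluid_state R N B)) by exact: measurableI.
have pi_range : pi (~` range (@fluid_state R N B)) = 0%E.
  by rewrite probability_setC// pi1 subee.
rewrite -lee_fin fineK ?fin_num_measure//.
apply: (@le_trans _ _ (pi (~` U `&` range (@fluid_state R N B)) +
    pi (~` range (@fluid_state R N B)))%E).
  apply: le_trans (measureU2 _ _ _) => //; last exact: measurableC.
  apply: le_measure; rewrite ?inE//.
    by apply: measurableU => //; exact: measurableC.
  move=> q nUq; have [qr|] := pselect (range (@fluid_state R N B) q).
    by left.
  by right.
rewrite pi_range adde0.
apply: (stationary_foster_lyapunov (f := fun x => c^-1 * lyapunov lambda x)
  _ (jsq_generator_jump lam d tau) Xjsq _ _ _ _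
  (V := borel (occ_space R B)) (mu := pi) _ pilim) => //.
- move=> [j|j] x //=; case: ifP => // _.
  by apply: mulr_ge0 => //; exact: assign_prob_ge0.
- apply: mulr_ge0 => //; apply: mulr_ge0; first exact: drift_const_ge0.
  by rewrite !addr_ge0// invr_ge0.
- by move=> x; apply: mulr_ge0 => //; exact: lyapunov_ge0.
- move=> x; rewrite driftZ -mulrBr; apply: ler_wpM2l => //.
  exact: drift_lyapunov.
- move=> M; apply: sub_finite_set (finite_lyapunov_le B N0 l0 (M * c)) => x /=.
  by rewrite mulrC ler_pdivrMr.
- exact: measurable_occ_set1.
- move=> x [nUx _]; rewrite mulrC ler_pdivlMr// mul1r leNgt.
  by apply/negP => /lyapU.
Qed.

Theorem proposition2p2
  (R : realType) (B : option nat) (B_ge1 : le_cap 1 B)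
  (lambda : R) (lambda_gt0 : 0 < lambda)
  (lambda_le_B : forall b, B = Some b -> lambda <= b%:R)
  (lam : nat -> R) (lam_gt0 : forall N, (0 < N)%N -> 0 < lam N)
  (lam_cvg : lam N / N%:R @[N --> \oo] --> lambda)
  (d : nat -> nat) (d_bounds : forall N, (0 < N)%N -> (1 <= d N <= N)%N)
  (d_cvg : d N @[N --> \oo] --> \oo)
  (tau : forall N, pool_state N B -> {set 'I_N} -> 'I_N -> R)
  (tau_rule : forall N, (0 < N)%N -> tie_breaking_rule (@tau N))
  (disp : nat -> measure_display)
  (Omega : forall N, measurableType (disp N))
  (Pr : forall N, probability (Omega N) R)
  (X : forall N, R -> Omega N -> pool_state N B)
  (X_jsq : forall N, (0 < N)%N ->
     jsq_process (lam N) (d N) (@tau N) (Pr N) (X N))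
  (pi : nat -> probability (borel (occ_space R B)) R)
  (pi_stat : forall N, (0 < N)%N ->
     stationary_occupancy_law (Pr N) (X N) (pi N)) :
  weak_cvg pi \d_(qstar B (ltW lambda_gt0) : borel (occ_space R B)).
Proof.
move=> phi cphi [M phiM]; set qs := qstar B _.
have mphi : measurable_fun [set: borel (occ_space R B)] phi.
  exact: continuous_borel_measurable.
have -> : (\int[\d_(qs : borel (occ_space R B))]_q (phi q)%:E)%E = (phi qs)%:E.
  by rewrite integral_dirac//; [rewrite diracT mul1e|exact/measurable_EFinP].
apply/fine_cvgP; split.
  apply: nearW => N; apply: integrable_fin_num => //.
  apply: measurable_bounded_integrable => //.
    by rewrite (le_lt_trans (probability_le1 _ _))// ltry.
  by exists M; split; [exact: num_real|move=> C MC q _; exact: le_trans (ltW MC)].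
apply/cvgrPdist_le => e e0.
have e2 : 0 < e / 2 by rewrite divr_gt0.
(* Small oscillation of [phi] on [U] handles one half of e, the mass outside [U] the other. *)
pose U : set (occ_space R B) := phi @^-1` ball (phi qs) (e / 2).
have oU : open U.
  by move/continuousP : cphi; apply; exact: (@ball_open R R^o).
have /lyapunov_small_fluid_near[c c0 lyapU] : nbhs qs U.
  by apply: open_nbhs_nbhs; split=> //; exact: ballxx.
pose C := (M + `|phi qs|) * (c^-1 * drift_const B lambda).
have M0 : 0 <= M by apply: le_trans (phiM qs).
have C0 : 0 <= C.
  apply: mulr_ge0; first exact: addr_ge0.
  by apply: mulr_ge0; [rewrite invr_ge0 ltW|exact: drift_const_ge0].
have C1 : 0 < C + 1 by rewrite ltr_wpDl.
(* Three errors of at most delta contribute 3 C delta <= e / 2; C + 1 keeps the denominator positive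
   when C = 0. *)
pose delta := e / 6 / (C + 1).
have delta0 : 0 < delta by rewrite !divr_gt0.
near=> N.
have N0 : (0 < N)%N by near: N; exact: nbhs_infty_gt.
have err1 : `|lam N / N%:R - lambda| <= delta.
  by near: N; exact: cvgr_distC_le lam_cvg _ delta0.
have err2 : (d N)%:R^-1 <= delta by near: N; exact: d_cvg _ (near_natV_le delta0).
have err3 : N%:R^-1 <= delta by near: N; exact: near_natV_le.
have l4 : `|lam N / N%:R - lambda| <= 4^-1.
  by near: N; apply: cvgr_distC_le lam_cvg _ _; rewrite invr_gt0.
have N4 : N%:R^-1 <= 4^-1 :> R by near: N; apply: near_natV_le; rewrite invr_gt0.
have mU : measurable (U : set (borel (occ_space R B))) by exact: measurable_borel.
have mass := stationary_mass_le N0 (ltW (lam_gt0 N N0)) (d_bounds N N0)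
  (tau_rule N N0) lambda_gt0 lambda_le_B l4 N4 (X_jsq N N0) (pi_stat N N0)
  mU c0 (lyapU N N0).
have dist := Rintegral_dist_le (pi N) mphi phiM mU (ltW e2) (c := phi qs).
rewrite distrC; apply: le_trans (dist _) _.
  by move=> q; rewrite /U/= -ball_normE/= distrC => /ltW.
rewrite [leRHS](_ : e = e / 2 + e / 2); last lra.
rewrite lerD2l.
apply: (@le_trans _ _ (C * (delta * 3))).
  rewrite /C -mulrA; apply: ler_wpM2l; first exact: addr_ge0.
  apply: le_trans mass _; rewrite -mulrA; apply: ler_wpM2l.
    by rewrite invr_ge0 ltW.
  by apply: ler_wpM2l; [exact: drift_const_ge0|lra].
have -> : e / 2 = (C + 1) * (delta * 3).
  by rewrite /delta; field; rewrite gt_eqF.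
by apply: ler_wpM2r; [rewrite mulr_ge0// ltW|rewrite lerDl].
Unshelve. all: by end_near.
Qed.
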